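(* Let $u_0\in \dot H^{2(1+1/p)}(\Omega)$, $u_0\neq0$, for some $p\in(1,\infty)$, let $g=\exp(\mathbb{L}T)u_0$, and for each sufficiently small $\delta>0$ let $g^\delta\in L^2(\Omega)$ satisfy $\|g-g^\delta\|_{L^2(\Omega)}\le\delta$. Let $s\ge1+\frac1p$ and let $\tilde g^\delta=w^{(i_* )}$ be the smoothed data obtained from $g^\delta$ by the Landweber iteration $w^{(i+1)}=w^{(i)}-\mu(-\mathbb{L})^{-2s}(w^{(i)}-g^\delta)$, $w^{(0)}=0$, stopped at an index $i_*=i_*(\delta)\in\mathbb{N}$ with $i_*\sim T^{-2}\log\bigl(\|u_0\|_{L^2(\Omega)}/\delta\bigr)$. For $\alpha\in(0,1)$ set $$u_0^\delta(\cdot;\alpha)=\sum_{k=1}^\infty\frac{1}{E_{\alpha,1}(-\lambda_kT^\alpha)}\,\langle\tilde g^\delta,\phi_k\rangle\,\phi_k .$$ Assume that $\alpha=\alpha(\tilde\delta)\in(0,1)$ is chosen such that $$\alpha(\tilde\delta)\nearrow1\quad\text{and}\quad\frac{\tilde\delta}{1-\alpha(\tilde\delta)}\to0\qquad\text{as }\tilde\delta\to0 .$$ Then $$\|u_0^\delta(\cdot;\alpha(\tilde\delta))-u_0\|_{L^2(\Omega)}\to0\qquad\text{as }\tilde\delta\to0 .$$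
   Context: $\Omega$ is a bounded, simply connected domain in Euclidean space with $C^2$ boundary; $\mathbb{L}$ is a uniformly elliptic second order partial differential operator with sufficiently smooth coefficients and homogeneous Dirichlet boundary conditions, with domain $H^2(\Omega)\cap H_0^1(\Omega)$, such that $-\mathbb{L}$ is self-adjoint and positive in $L^2(\Omega)$. Its eigenvalues, counted with multiplicity, are $0<\lambda_1\le\lambda_2\le\dots$, with $L^2(\Omega)$-orthonormal eigenfunctions $\phi_k$; $\langle\cdot,\cdot\rangle$ is the $L^2(\Omega)$ inner product. $T>0$ is fixed. Operators are defined spectrally: $(-\mathbb{L})^\beta f=\sum_k\lambda_k^\beta\langle f,\phi_k\rangle\phi_k$ and $\exp(\mathbb{L}T)f=\sum_k e^{-\lambda_kT}\langle f,\phi_k\rangle\phi_k$. For $r\geq 0$, $\dot H^r(\Omega)=\{v\in L^2(\Omega):\|v\|_{\dot H^r}^2=\sum_k\lambda_k^r\langle v,\phi_k\rangle^2<\infty\}$. $E_{\alpha,1}(z)=\sum_{k=0}^\infty z^k/\Gamma(\alpha k+1)$ is the Mittag-Leffler function. The constant $\mu>0$ is fixed such that $\|\mu(-\mathbb{L})^{-2s}\|_{L^2\to L^2}\le1$. The notation $i_*\sim X(\delta)$ means $c\,X(\delta)\le i_*\le C\,X(\delta)$ for all small $\delta$ with constants $0<c\le C$ independent of $\delta$. The quantity $\tilde\delta$ is $\tilde\delta=C_2\,T^{-1}\,\delta\,\sqrt{\log(\|u_0\|_{L^2(\Omega)}/\delta)}$, where $C_2>0$ is a fixed constant independent of $T$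 and $\delta$; the limit $\tilde\delta\to0$ is understood as the limit $\delta\to0$. *)

(* Defs.v *)
From HB Require Import structures.
From mathcomp Require Import all_boot all_order all_algebra.
From mathcomp Require Import all_classical all_reals all_analysis.

Set Implicit Arguments.
Unset Strict Implicit.
Unset Printing Implicit Defensive.

Import Order.TTheory GRing.Theory Num.Theory.
Import numFieldNormedType.Exports.

Local Open Scope classical_set_scope.
Local Open Scope ring_scope.

(** The dimension of the Euclidean space is d = n.+1, so d >= 1.  Lebesgue
    outer measure is the infimum of the total volume over countable covers by
    closed boxes, and Lebesgue measure is its restriction to the Caratheodory
    measurable sets. *)
Definition box (R : realType) (n : nat) (ab : 'rV[R]_n.+1 * 'rV[R]_n.+1) :
    set 'rV[R]_n.+1 :=
  [set x | forall i, ab.1 ord0 i <= x ord0 i <= ab.2 ord0 i].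

Definition box_volume (R : realType) (n : nat)
    (ab : 'rV[R]_n.+1 * 'rV[R]_n.+1) : R :=
  \prod_(i < n.+1) Num.max 0 (ab.2 ord0 i - ab.1 ord0 i).

Definition lebesgue_outer (R : realType) (n : nat) (A : set 'rV[R]_n.+1) :
    \bar R :=
  ereal_inf [set (\sum_(k <oo) (box_volume (B k))%:E)%E
            | B in [set B : nat -> 'rV[R]_n.+1 * 'rV[R]_n.+1
                   | A `<=` \bigcup_k box (B k)]].

Lemma box_volume_ge0 (R : realType) (n : nat)
    (ab : 'rV[R]_n.+1 * 'rV[R]_n.+1) : 0 <= box_volume ab.
Proof. by apply: prodr_ge0 => i _; rewrite le_max lexx. Qed.

Lemma lebesgue_outer_ge0 (R : realType) (n : nat) (A : set 'rV[R]_n.+1) :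
  (0 <= lebesgue_outer A)%E.
Proof.
apply: le_ereal_inf_tmp => _ [B _ <-]; apply: nneseries_ge0 => k _ _.
by rewrite lee_fin box_volume_ge0.
Qed.

Lemma lebesgue_outer0 (R : realType) (n : nat) :
  lebesgue_outer (set0 : set 'rV[R]_n.+1) = 0%E.
Proof.
apply/eqP; rewrite eq_le lebesgue_outer_ge0 andbT.
apply: ereal_inf_lbound; exists (fun=> (0, 0)) => //=.
apply: eseries0 => k _ _; congr (_%:E).
by rewrite /box_volume big_ord_recl subrr maxxx mul0r.
Qed.

Lemma le_lebesgue_outer (R : realType) (n : nat) :
  {homo @lebesgue_outer R n : A B / A `<=` B >-> (A <= B)%E}.
Proof.
move=> A B AB; apply/ereal_inf_le_tmp => x [F BF <-].
by exists F => //; exact: subset_trans AB BF.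
Qed.

Lemma lebesgue_outer_sigma_subadditive (R : realType) (n : nat) :
  sigma_subadditive (@lebesgue_outer R n).
Proof.
pose mu := @lebesgue_outer R n.
pose vol (ab : 'rV[R]_n.+1 * 'rV[R]_n.+1) : \bar R := (box_volume ab)%:E.
have vol0 ab : (0 <= vol ab)%E by rewrite lee_fin box_volume_ge0.
move=> A; have [[i ioo]|] := pselect (exists i, mu (A i) = +oo%E).
  rewrite (eseries_pinfty _ _ ioo) ?leey// => k _.
  by rewrite -ltNye (lt_le_trans _ (lebesgue_outer_ge0 _)).
rewrite -forallNE => Aoo.
suff add2e (e : {posnum R}) :
    (mu (\bigcup_n A n) <= \sum_(i <oo) mu (A i) + e%:num%:E)%E.
  by apply/lee_addgt0Pr => _/posnumP[].
rewrite (le_trans _ (epsilon_trick _ _ _))//; last first.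
  by move=> k; exact: lebesgue_outer_ge0.
pose P k (B : nat -> 'rV[R]_n.+1 * 'rV[R]_n.+1) :=
  A k `<=` \bigcup_j box (B j) /\
  (\sum_(j <oo) vol (B j) <= mu (A k) + (e%:num / (2 ^ k.+1)%:R)%:E)%E.
have [G PG] : {G : nat -> nat -> 'rV[R]_n.+1 * 'rV[R]_n.+1
                 & forall k, P k (G k)}.
  apply: (@choice _ _ P) => k; rewrite /P /mu /lebesgue_outer.
  set S := (X in ereal_inf X); move infS : (ereal_inf S) => iS.
  case: iS infS => [r Sr|Soo|Soo].
  - have en1 : (0 < e%:num / (2 ^ k.+1)%:R)%R by [].
    have /(lb_ereal_inf_adherent en1) : ereal_inf S \is a fin_num by rewrite Sr.
    move=> [x [B AnB muBx] xS].
    by exists B; split => //; rewrite muBx -Sr; exact/ltW.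
  - by have := Aoo k; rewrite /mu /lebesgue_outer Soo.
  - suff : lbound S 0%E by move/le_ereal_inf_tmp; rewrite Soo.
    by move=> /= _ [B AnB <-]; apply: nneseries_ge0 => k0 _ _; exact: vol0.
have volG_ge0 x : (0 <= (vol \o uncurry G) x)%E by exact: vol0.
apply: (@le_trans _ _ (\esum_(i in setT) (vol \o uncurry G) i)%E).
  apply: ereal_inf_lbound => /=.
  have /card_esym/ppcard_eqP[f] := card_nat2.
  exists (uncurry G \o f).
    apply: (@subset_trans _  (\bigcup_k \bigcup_j box (G k j))) => [t [i _]|].
      by move=> /((PG i).1) -[j _ ?]; exists i => //; exists j.
    move=> t [i _ [j _ Bijt]]; exists (f^-1%FUN (i, j)) => //=.
    by rewrite invK ?inE.
  rewrite -(esum_pred_image (vol \o uncurry G) _ xpredT) ?[fun=> _]set_true//.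
  by rewrite image_eq.
rewrite (_ : esum _ _ = (\sum_(i <oo) \sum_(j <oo ) vol (G i j))%E); last first.
  pose J : nat -> set (nat * nat) := fun i => [set (i, j) | j in setT].
  rewrite (_ : setT = \bigcup_k J k); last first.
    by rewrite predeqE => -[a b]; split => // _; exists a => //; exists b.
  rewrite esum_bigcupT /=; last 2 first.
    - apply/trivIsetP => i j _ _ ij.
      rewrite predeqE => -[k m] /=; split => //= -[] [_] _ [<-{k} _].
      by move=> [m' _] [] /esym/eqP; rewrite (negbTE ij).
    - by move=> /= [k m]; exact: vol0.
  rewrite -(image_id [set: nat]) -fun_true esum_pred_image//; last first.
    by move=> k _; exact: esum_ge0.
  apply: eq_eseriesr => /= j _.
  rewrite -(esum_pred_image (vol \o uncurry G) (pair j) predT)//=; last first.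
    by move=> ? ? _ _; exact: (@can_inj _ _ _ snd).
  by congr esum; rewrite predeqE => -[a b]; split; move=> [i _ <-]; exists i.
apply: lee_lim.
- apply: is_cvg_nneseries => k *.
  by apply: nneseries_ge0 => m *; exact: (volG_ge0 (k, m)).
- by apply: is_cvg_nneseries => k *; apply: adde_ge0 => //; exact: lebesgue_outer_ge0.
- by apply: nearW => k; apply: lee_sum => i _; exact: (PG i).2.
Qed.

HB.instance Definition _ (R : realType) (n : nat) :=
  isOuterMeasure.Build R 'rV[R]_n.+1 (@lebesgue_outer R n)
    (@lebesgue_outer0 R n) (@lebesgue_outer_ge0 R n)
    (@le_lebesgue_outer R n) (@lebesgue_outer_sigma_subadditive R n).

Notation lebesgueRV R n := (caratheodory_type (@lebesgue_outer R n)).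

Definition lebesgueRV_measure (R : realType) (n : nat) :
    set (lebesgueRV R n) -> \bar R := @lebesgue_outer R n.

HB.instance Definition _ (R : realType) (n : nat) :=
  isMeasure.Build _ (lebesgueRV R n) R (@lebesgueRV_measure R n)
    (@caratheodory_measure0 R _ (@lebesgue_outer R n))
    (@caratheodory_measure_ge0 R _ (@lebesgue_outer R n))
    (@caratheodory_measure_sigma_additive R _ (@lebesgue_outer R n)).

(** Elements of L^2(Omega) are represented by functions on R^d, of which only
    the restriction to Omega matters, up to almost everywhere equality. *)
Definition L2 (R : realType) (n : nat) (Omega : set 'rV[R]_n.+1)
    (f : 'rV[R]_n.+1 -> R) : Prop :=
  @measurable_fun _ _ (lebesgueRV R n) R Omega f /\
  (\int[@lebesgueRV_measure R n]_(x in Omega) ((f x) ^+ 2)%:E < +oo)%E.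

Definition L2inner (R : realType) (n : nat) (Omega : set 'rV[R]_n.+1)
    (f g : 'rV[R]_n.+1 -> R) : R :=
  \int[@lebesgueRV_measure R n]_(x in Omega) (f x * g x).

Definition L2norm (R : realType) (n : nat) (Omega : set 'rV[R]_n.+1)
    (f : 'rV[R]_n.+1 -> R) : R := Num.sqrt (L2inner Omega f f).

Definition ae_on (R : realType) (n : nat) (Omega : set 'rV[R]_n.+1)
    (P : 'rV[R]_n.+1 -> Prop) : Prop :=
  {ae @lebesgueRV_measure R n, forall x, Omega x -> P x}.

Definition partial (R : realType) (n : nat) (i : 'I_n) (f : 'rV[R]_n -> R) :
    'rV[R]_n -> R := fun x => 'D_(delta_mx ord0 i) f x.

Fixpoint Ck (R : realType) (n k : nat) (f : 'rV[R]_n -> R) : Prop :=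
  continuous f /\
  if k is k'.+1 then
    forall i, (forall x, derivable f x (delta_mx ord0 i)) /\
              Ck k' (partial i f)
  else True.

(** Near each of its points the boundary is the graph of a C^2 function over
    the coordinate hyperplane orthogonal to some axis, with Omega on exactly
    one side; [sgn] tells which one.  [col' i y] is [y] without its i-th
    coordinate. *)
Definition C2_boundary (R : realType) (n : nat) (Omega : set 'rV[R]_n.+1) :
    Prop :=
  forall x, (closure Omega `\` interior Omega) x ->
  exists (r : R) (i : 'I_n.+1) (sgn : bool) (gamma : 'rV[R]_n -> R),
    [/\ 0 < r, Ck 2 gamma &
        Omega `&` ball x r =
        [set y | gamma (col' i y) < (-1) ^+ sgn * y ord0 i] `&` ball x r].

Definition simply_connected (R : realType) (n : nat) (Omega : set 'rV[R]_n) :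
    Prop :=
  connected Omega /\
  forall loop : R -> 'rV[R]_n,
    {within `[0, 1], continuous loop} ->
    (forall t, t \in `[0, 1] -> Omega (loop t)) ->
    loop 0 = loop 1 ->
  exists H : R * R -> 'rV[R]_n,
    [/\ {within `[0, 1] `*` `[0, 1], continuous H},
        forall s t, s \in `[0, 1] -> t \in `[0, 1] -> Omega (H (s, t)),
        forall t, t \in `[0, 1] -> H (0, t) = loop t,
        forall t, t \in `[0, 1] -> H (1, t) = loop 0 &
        forall s, s \in `[0, 1] -> H (s, 0) = loop 0 /\ H (s, 1) = loop 0].

Definition admissible_domain (R : realType) (n : nat)
    (Omega : set 'rV[R]_n.+1) : Prop :=
  [/\ Omega !=set0, open Omega, bounded_set Omega, simply_connected Omega &
      C2_boundary Omega].

Definition test_function (R : realType) (n : nat) (Omega : set 'rV[R]_n.+1)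
    (f : 'rV[R]_n.+1 -> R) : Prop :=
  [/\ forall k, Ck k f, compact (closure [set x | f x != 0]) &
      closure [set x | f x != 0] `<=` Omega].

Definition weak_partial (R : realType) (n : nat) (Omega : set 'rV[R]_n.+1)
    (i : 'I_n.+1) (u v : 'rV[R]_n.+1 -> R) : Prop :=
  forall f, test_function Omega f ->
    L2inner Omega u (partial i f) = - L2inner Omega v f.

(** [u] is in H^1(Omega) with weak gradient [du]. *)
Definition in_H1 (R : realType) (n : nat) (Omega : set 'rV[R]_n.+1)
    (u : 'rV[R]_n.+1 -> R) (du : 'I_n.+1 -> 'rV[R]_n.+1 -> R) : Prop :=
  L2 Omega u /\ forall i, L2 Omega (du i) /\ weak_partial Omega i u (du i).

(** [u] is in H^2(Omega) with weak gradient [du] and weak Hessian [d2u]. *)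
Definition in_H2 (R : realType) (n : nat) (Omega : set 'rV[R]_n.+1)
    (u : 'rV[R]_n.+1 -> R) (du : 'I_n.+1 -> 'rV[R]_n.+1 -> R)
    (d2u : 'I_n.+1 -> 'I_n.+1 -> 'rV[R]_n.+1 -> R) : Prop :=
  in_H1 Omega u du /\ forall i, in_H1 Omega (du i) (d2u i).

(** [u], with weak gradient [du], is in the H^1-closure of the test
    functions. *)
Definition in_H10 (R : realType) (n : nat) (Omega : set 'rV[R]_n.+1)
    (u : 'rV[R]_n.+1 -> R) (du : 'I_n.+1 -> 'rV[R]_n.+1 -> R) : Prop :=
  in_H1 Omega u du /\
  exists f : nat -> 'rV[R]_n.+1 -> R,
    [/\ forall m, test_function Omega (f m),
        (fun m => L2norm Omega (f m \- u)) @ \oo --> (0 : R) &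
        forall i, (fun m => L2norm Omega (partial i (f m) \- du i)) @ \oo
                    --> (0 : R)].

(** L u = sum_ij a_ij d_i d_j u + sum_i b_i d_i u + c u, with domain
    H^2(Omega) /\ H^1_0(Omega).  Unbounded operators in L^2(Omega) are
    represented by their graphs. *)
Record elliptic_coef (R : realType) (n : nat) := EllipticCoef {
  ec_a : 'I_n.+1 -> 'I_n.+1 -> 'rV[R]_n.+1 -> R;
  ec_b : 'I_n.+1 -> 'rV[R]_n.+1 -> R;
  ec_c : 'rV[R]_n.+1 -> R }.

(** C^1 regularity up to the boundary: the coefficients are restrictions to
    Omega of C^1 functions on R^d. *)
Definition smooth_coef (R : realType) (n : nat) (K : elliptic_coef R n) :
    Prop :=
  [/\ forall i j, Ck 1 (ec_a K i j), forall i, Ck 1 (ec_b K i) &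
      Ck 1 (ec_c K)].

Definition uniformly_elliptic (R : realType) (n : nat)
    (Omega : set 'rV[R]_n.+1) (K : elliptic_coef R n) : Prop :=
  (forall x i j, Omega x -> ec_a K i j x = ec_a K j i x) /\
  exists2 theta : R, 0 < theta &
    forall x (xi : 'I_n.+1 -> R), Omega x ->
      theta * \sum_(i < n.+1) xi i ^+ 2 <=
      \sum_(i < n.+1) \sum_(j < n.+1) ec_a K i j x * xi i * xi j.

(** The graph of -L. *)
Definition neg_elliptic_op (R : realType) (n : nat)
    (Omega : set 'rV[R]_n.+1) (K : elliptic_coef R n)
    (u f : 'rV[R]_n.+1 -> R) : Prop :=
  exists du d2u,
    [/\ in_H2 Omega u du d2u, in_H10 Omega u du, L2 Omega f &
        ae_on Omega (fun x =>
          f x = - (\sum_(i < n.+1) \sum_(j < n.+1) ec_a K i j x * d2u i j x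
                   + \sum_(i < n.+1) ec_b K i x * du i x
                   + ec_c K x * u x))].

(** The graph coincides with the graph of its adjoint. *)
Definition self_adjoint (R : realType) (n : nat) (Omega : set 'rV[R]_n.+1)
    (A : ('rV[R]_n.+1 -> R) -> ('rV[R]_n.+1 -> R) -> Prop) : Prop :=
  forall v h, L2 Omega v -> L2 Omega h ->
    (A v h <->
     forall u f, A u f -> L2inner Omega f v = L2inner Omega u h).

Definition positive_op (R : realType) (n : nat) (Omega : set 'rV[R]_n.+1)
    (A : ('rV[R]_n.+1 -> R) -> ('rV[R]_n.+1 -> R) -> Prop) : Prop :=
  forall u f, A u f -> ~ ae_on Omega (fun x => u x = 0) ->
    0 < L2inner Omega f u.

(** Eigenvalues in nondecreasing order, repeated according to multiplicity,
    with an orthonormal basis of eigenfunctions.  Indices start at 0, so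
    [lam k] and [phi k] are lambda_(k+1) and phi_(k+1).  Completeness of [phi]
    is what makes the enumeration exhaustive. *)
Definition eigensystem (R : realType) (n : nat) (Omega : set 'rV[R]_n.+1)
    (A : ('rV[R]_n.+1 -> R) -> ('rV[R]_n.+1 -> R) -> Prop)
    (lam : nat -> R) (phi : nat -> 'rV[R]_n.+1 -> R) : Prop :=
  [/\ 0 < lam 0%N,
      forall j k, (j <= k)%N -> lam j <= lam k,
      forall k, A (phi k) (fun x => lam k * phi k x),
      forall j k, L2inner Omega (phi j) (phi k) = (j == k)%:R &
      forall f, L2 Omega f -> (forall k, L2inner Omega f (phi k) = 0) ->
        ae_on Omega (fun x => f x = 0)].

Definition L2_sum (R : realType) (n : nat) (Omega : set 'rV[R]_n.+1)
    (v : nat -> 'rV[R]_n.+1 -> R) (u : 'rV[R]_n.+1 -> R) : Prop :=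
  L2 Omega u /\
  (fun N => L2norm Omega (fun x => \sum_(0 <= k < N) v k x - u x)) @ \oo
    --> (0 : R).

(** The L^2(Omega)-sum of m_k <f, phi_k> phi_k; the junk value is 0 if the
    series does not converge in L^2(Omega). *)
Definition spectral_op (R : realType) (n : nat) (Omega : set 'rV[R]_n.+1)
    (phi : nat -> 'rV[R]_n.+1 -> R) (m : nat -> R) (f : 'rV[R]_n.+1 -> R) :
    'rV[R]_n.+1 -> R :=
  xget (fun=> 0)
    (L2_sum Omega (fun k x => m k * L2inner Omega f (phi k) * phi k x)).

Definition frac_power (R : realType) (n : nat) (Omega : set 'rV[R]_n.+1)
    (lam : nat -> R) (phi : nat -> 'rV[R]_n.+1 -> R) (beta : R) :=
  spectral_op Omega phi (fun k => lam k `^ beta).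

Definition exp_op (R : realType) (n : nat) (Omega : set 'rV[R]_n.+1)
    (lam : nat -> R) (phi : nat -> 'rV[R]_n.+1 -> R) (T : R) :=
  spectral_op Omega phi (fun k => expR (- (lam k * T))).

Definition dotH (R : realType) (n : nat) (Omega : set 'rV[R]_n.+1)
    (lam : nat -> R) (phi : nat -> 'rV[R]_n.+1 -> R) (r : R)
    (v : 'rV[R]_n.+1 -> R) : Prop :=
  L2 Omega v /\
  (\sum_(k <oo) (lam k `^ r * L2inner Omega v (phi k) ^+ 2)%:E < +oo)%E.

Definition Gamma (R : realType) (x : R) : R :=
  \int[lebesgue_measure]_(t in `]0, +oo[) (t `^ (x - 1) * expR (- t)).

Definition mittag_leffler (R : realType) (alpha beta z : R) : R :=
  limn (series (fun k => z ^+ k / Gamma (alpha * k%:R + beta))).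

Fixpoint landweber (R : realType) (n : nat) (Omega : set 'rV[R]_n.+1)
    (lam : nat -> R) (phi : nat -> 'rV[R]_n.+1 -> R) (mu s : R)
    (gd : 'rV[R]_n.+1 -> R) (i : nat) : 'rV[R]_n.+1 -> R :=
  if i is i'.+1 then
    let w := landweber Omega lam phi mu s gd i' in
    fun x => w x - mu * frac_power Omega lam phi (- (2 * s)) (w \- gd) x
  else fun=> 0.

Definition reconstruction (R : realType) (n : nat) (Omega : set 'rV[R]_n.+1)
    (lam : nat -> R) (phi : nat -> 'rV[R]_n.+1 -> R) (T alpha : R) :=
  spectral_op Omega phi
    (fun k => (mittag_leffler alpha 1 (- lam k * T `^ alpha))^-1).

Definition delta_tilde (R : realType) (C2 T u0norm delta : R) : R :=
  C2 * T^-1 * delta * Num.sqrt (ln (u0norm / delta)).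

(* Main.v *)
Require Import Defs.
From HB Require Import structures.
From mathcomp Require Import all_boot all_order all_algebra.
From mathcomp Require Import all_classical all_reals all_analysis.
From mathcomp Require Import measurable_realfun ring lra.

(** Expand everything in the eigenbasis.  After i Landweber steps the k-th
    coefficient of the data is damped by q_k = 1 - (1 - mu lambda_k^(-2s))^i, so
    the k-th error coefficient is
      (q_k e^(-lambda_k T) / E_k - 1) <u_0, phi_k> + (q_k / E_k) noise_k,
    where E_k = E_{alpha,1}(- lambda_k T^alpha).  As s >= 1,
    q_k lambda_k <= C sqrt i, and 1 / E_k <= 1 + C lambda_k / (1 - alpha), so the
    noise contributes at most C delta (1 + sqrt i / (1 - alpha)), which is of
    order delta + delta~ / (1 - alpha).  The first term tends to 0 for every k
    and its multiplier is bounded uniformly in k and alpha, so it vanishes by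
    dominated convergence for series.

    The bounds on E_{alpha,1} come from a discretisation: with
    u(z) = (1 - z)^(-1) / (1 + eps (1 - z)^(-alpha)) = sum_n u_n z^n, the
    Gauss-Euler limit for Gamma gives u_n -> E_{alpha,1}(- x) for
    eps = x n^(-alpha), and the u_n satisfy a recursion whose weights are
    nonnegative and sum to 1, which makes both lower bounds
    (1 - alpha) / (x + 1 - alpha) and exp(- x / Gamma(1 + alpha)) elementary
    inductions. *)

Set Implicit Arguments.
Unset Strict Implicit.
Unset Printing Implicit Defensive.

Import Order.TTheory GRing.Theory Num.Theory.
Import numFieldNormedType.Exports.

Local Open Scope classical_set_scope.
Local Open Scope ring_scope.

(** * The Gamma integral *)

Section gamma_integral.
Context {R : realType}.
Notation mu := (@lebesgue_measure R).
Implicit Types a x y : R.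

(** The series of E_{alpha,1}(- x) alternates, so neither its sign nor its size can be read off its
    terms. A comparison argument is available for the discretisation: multiplying u by (1 - z)^alpha
    gives (1 - z)^alpha u + eps u = (1 - z)^(alpha - 1), and the coefficients of (1 - z)^alpha after
    the first are nonpositive, so each u_n is determined by earlier values with nonnegative weights.
    Inequalities for u_n then survive the limit n -> oo. Two lower bounds are needed because neither
    suffices alone. The rational one loses only a power of lambda, but its constant vanishes as
    alpha -> 1. The exponential one tends to exp(- lambda T) as alpha -> 1, but loses a factor exp(2
    lambda (1 - alpha)). Switching at lambda (1 - alpha) = 1 bounds exp(- lambda T) / E_k uniformly
    in k and alpha. What is needed about Gamma (positivity, asymptotics, limits at integers) comes
    from the functional equation, the factorial values and Wendel's inequality. *)

Lemma continuous_expRN_half : continuous (fun t : R => expR (- (t / 2))).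
Proof.
move=> x; apply: (@continuous_comp _ _ _ (fun x : R => - (x / 2)) expR).
  by apply: continuousN; apply: cvgMl; exact: cvg_id.
exact: continuous_expR.
Qed.

Lemma cvg_expRN_half : expR (- (t / 2)) @[t --> +oo] --> (0 : R).
Proof.
have H : (fun t : R => t / 2) t @[t --> +oo] --> +oo.
  apply/cvgryPge => A; near=> t.
  by rewrite ler_pdivlMr//; near: t; exact: nbhs_pinfty_ge.
exact: (cvg_comp _ _ H (@cvgr_expR R)).
Unshelve. all: by end_near. Qed.

Lemma integral_expRN_half :
  (\int[mu]_(t in `[0%R, +oo[) (expR (- (t / 2)))%:E = 2%:E)%E.
Proof.
rewrite (@ge0_continuous_FTC2y _ _ (fun t => - 2 * expR (- (t / 2))) 0 0).
- by rewrite mul0r oppr0 expR0 mulr1 -EFinB; congr (_%:E); ring.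
- by move=> x _; exact: expR_ge0.
- by apply: continuous_subspaceT => x; exact: continuous_expRN_half.
- rewrite -[X in _ --> X](mulr0 (-2)); apply: cvgMr; exact: cvg_expRN_half.
- by move=> x _; apply: ex_derive.
- by apply: cvgMr; apply: cvg_at_right_filter; exact: continuous_expRN_half.
- move=> x _; rewrite derive1E.
  by rewrite derive_val /GRing.scale/=; field.
Qed.

Lemma integrable_expRN_half :
  mu.-integrable `]0%R, +oo[ (fun t => (expR (- (t / 2)))%:E).
Proof.
have mf D : measurable_fun D (fun t : R => expR (- (t / 2))).
  apply: measurable_funTS; apply: continuous_measurable_fun.
  exact: continuous_expRN_half.
have mE D : measurable_fun D (EFin \o (fun t : R => expR (- (t / 2)))).
  exact/measurable_EFinP.
apply/integrableP; split; first exact: mE.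
under eq_integral do rewrite gee0_abs ?lee_fin ?expR_ge0//.
rewrite integral_itv_obnd_cbnd; last exact: mE.
by rewrite integral_expRN_half ltry.
Qed.

Lemma Rintegral_expRN_half :
  \int[mu]_(t in `]0%R, +oo[) expR (- (t / 2)) = 2.
Proof.
rewrite Rintegral_itv_obnd_cbnd; last exact: integrable_expRN_half.
by rewrite /Rintegral integral_expRN_half.
Qed.

(** Half of the exponential absorbs the power: y <= exp y at y = t / (2 a), raised to the power a,
    yields the constant (2 a)^a. *)
Lemma powR_expRN_le a : 0 <= a -> exists2 C : R, 0 <= C &
  forall t, 0 <= t -> t `^ a * expR (- t) <= C * expR (- (t / 2)).
Proof.
rewrite le_eqVlt => /predU1P[<-|a0].
  exists 1 => // t t0; rewrite powRr0 !mul1r ler_expR lerN2.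
  by rewrite ler_pdivrMr// ler_peMr// ler1n.
exists ((2 * a) `^ a); first exact: powR_ge0.
move=> t t0; rewrite [X in expR (- X)](splitr t) opprD expRD mulrA.
rewrite ler_wpM2r ?expR_ge0//.
have {1}-> : t = (2 * a) * (t / (2 * a)) by field; rewrite gt_eqF.
have aa : 0 <= 2 * a by rewrite mulr_ge0// ltW.
have ta : 0 <= t / (2 * a) by rewrite divr_ge0.
rewrite powRM// -mulrA ler_piMr ?powR_ge0//.
rewrite expRN ler_pdivrMr ?expR_gt0// mul1r.
have -> : expR (t / 2) = expR (t / (2 * a)) `^ a.
  by rewrite -expRM; congr expR; field; rewrite gt_eqF.
apply: ge0_ler_powR; rewrite ?nnegrE ?expR_ge0//; first exact: ltW.
by apply: le_trans (expR_ge1Dx _); rewrite lerDr.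
Qed.

Lemma measurable_powR_expRN a D :
  measurable_fun D (fun t : R => t `^ a * expR (- t)).
Proof.
apply: measurable_funTS; apply: measurable_funM; first exact: measurable_powR.
by apply: measurableT_comp => //; exact: oppr_measurable.
Qed.

Lemma integrable_powR_expRN a : 0 <= a ->
  mu.-integrable `]0%R, +oo[ (fun t => (t `^ a * expR (- t))%:E).
Proof.
move=> /powR_expRN_le[C C0 HC].
have mE : measurable_fun (`]0%R, +oo[ : set R) (EFin \o (fun t : R => t `^ a * expR (- t))).
  by apply/measurable_EFinP; exact: measurable_powR_expRN.
apply: le_integrable; last by apply: (integrableZl _ C integrable_expRN_half).
- by [].
- exact: mE.
move=> t; rewrite /= in_itv/= andbT => t0.
rewrite lee_fin !ger0_norm ?HC ?mulr_ge0 ?expR_ge0 ?powR_ge0//.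
exact: ltW.
Qed.

Lemma GammaE x : Gamma x = \int[mu]_(t in `]0%R, +oo[) (t `^ (x - 1) * expR (- t)).
Proof. by []. Qed.

(** For a = 0 the convention that zero to the power zero is 1 makes the limit agree with the value
    at 0, so the integrands below are continuous on the closed half-line. *)
Lemma powR_at0 a : 0 <= a -> t `^ a @[t --> 0^'+] --> (0 `^ a : R).
Proof.
rewrite le_eqVlt => /predU1P[<-|a0].
  rewrite powRr0 (_ : (fun t : R => t `^ 0) = cst 1); first exact: cvg_cst.
  by apply/funext => t; rewrite powRr0.
by rewrite powR0 ?gt_eqF//; exact: powR_cvg0.
Qed.

(** Integration by parts, but the derivative of - t^(a+1) exp(- t) changes sign, whereas the
    fundamental theorem on a half-line is applied to a nonnegative integrand. Adding (a+1) C exp(-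
    t/2), which dominates the negative part and has an explicit integral, restores the sign; it is
    subtracted again at the end. *)
Lemma GammaS a : 0 <= a -> Gamma (a + 2) = (a + 1) * Gamma (a + 1).
Proof.
move=> a0; have a10 : 0 <= a + 1 by rewrite addr_ge0.
have [C C0 HC] := powR_expRN_le a0.
have [C' C'0 HC'] := powR_expRN_le a10.
pose w b (t : R) := t `^ b * expR (- t).
pose h (t : R) := expR (- (t / 2)).
pose f (t : R) := w (a + 1) t - (a + 1) * w a t + (a + 1) * C * h t.
pose F (t : R) := - w (a + 1) t - 2 * ((a + 1) * C) * h t.
have dw x : 0 < x -> is_derive x 1 (w (a + 1)) ((a + 1) * w a x - w (a + 1) x).
  move=> x0; have dp := is_derive1_powR (a + 1) x0; rewrite /w.
  apply: is_derive_eq.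
  rewrite /w /GRing.scale/=; have -> : a + 1 - 1 = a by ring.
  ring.
have dF x : 0 < x -> is_derive x 1 F (f x).
  move=> x0; have dwx := dw _ x0; rewrite /F.
  apply: is_derive_eq; rewrite /f /GRing.scale/=.
  by rewrite /h; field.
have wc b : 0 <= b -> {within `[0, +oo[, continuous (w b)}.
  move=> b0; apply/continuous_within_itvcyP; split.
    move=> x; rewrite in_itv/= andbT => x0.
    have pc : {for x, continuous (fun t : R => t `^ b)}.
      apply: differentiable_continuous; apply/derivable1_diffP.
      by apply: derivable_powR; rewrite in_itv/= andbT.
    apply: cvgM; first exact: pc.
    apply: (@continuous_comp _ _ _ -%R expR); last exact: continuous_expR.
    exact: opp_continuous.
  apply: cvgM; first exact: powR_at0.
  apply: cvg_at_right_filter.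
  apply: (@continuous_comp _ _ _ -%R expR); last exact: continuous_expR.
  exact: opp_continuous.
have winf : w (a + 1) t @[t --> +oo] --> (0 : R).
  apply: (@squeeze_cvgr _ _ _ _ (fun=> 0) (fun t => C' * h t)).
  - near=> t; rewrite /w mulr_ge0 ?powR_ge0 ?expR_ge0//=; apply: HC'.
    by near: t; apply: nbhs_pinfty_ge.
  - exact: cvg_cst.
  - by rewrite -[X in _ --> X](mulr0 C'); apply: cvgMr; exact: cvg_expRN_half.
have If : (\int[mu]_(x in `[0%R, +oo[) (f x)%:E = 0%:E - (F 0)%:E)%E.
  apply: ge0_continuous_FTC2y.
  - move=> x x0; rewrite /f -addrA addr_ge0//.
      by rewrite mulr_ge0 ?powR_ge0 ?expR_ge0.
    rewrite addrC -mulrA -mulrBr mulr_ge0// subr_ge0; exact: HC.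
  - have hc : {within `[0, +oo[, continuous h}.
      by apply: continuous_subspaceT => x; exact: continuous_expRN_half.
    move=> x; apply: cvgD; first apply: cvgB.
    + exact: wc.
    + by apply: cvgMr; exact: wc.
    + by apply: cvgMr; exact: hc.
  - rewrite -[X in _ --> X](_ : - 0 - 2 * ((a + 1) * C) * 0 = 0); last by ring.
    apply: cvgB; first exact: cvgN.
    by apply: cvgMr; exact: cvg_expRN_half.
  - by move=> x x0; apply: ex_derive; exact: dF.
  - apply: cvgB; first apply: cvgN.
      by have /continuous_within_itvcyP[] := wc _ a10.
    by apply: cvgMr; apply: cvg_at_right_filter; exact: continuous_expRN_half.
  - move=> x; rewrite in_itv/= andbT => x0.
    by rewrite derive1E; have /@derive_val := dF _ x0.
have iw b : 0 <= b -> mu.-integrable `]0%R, +oo[ (EFin \o w b).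
  exact: integrable_powR_expRN.
have iw1 : mu.-integrable `]0%R, +oo[ (EFin \o (fun t => (a + 1) * w a t)).
  apply: eq_integrable (integrableZl _ (a + 1) (iw _ a0)) => //.
have ih1 : mu.-integrable `]0%R, +oo[ (EFin \o (fun t => (a + 1) * C * h t)).
  apply: eq_integrable (integrableZl _ ((a + 1) * C) integrable_expRN_half) => //.
have ifw : mu.-integrable `]0%R, +oo[ (EFin \o (fun t => w (a + 1) t - (a + 1) * w a t)).
  apply: eq_integrable (integrableB _ (iw _ a10) iw1) => //.
have : \int[mu]_(x in `]0%R, +oo[) f x = 2 * ((a + 1) * C).
  rewrite Rintegral_itv_obnd_cbnd; last first.
    by apply: eq_integrable (integrableD _ ifw ih1).
  rewrite /Rintegral If /= /F /w /h powR0 ?gt_eqF ?ltr_wpDl//.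
  by rewrite !mul0r !oppr0 expR0; ring.
rewrite /f RintegralD// RintegralB//; last exact: iw.
have -> : \int[mu]_(x in `]0%R, +oo[) ((a + 1) * w a x) =
    (a + 1) * \int[mu]_(x in `]0%R, +oo[) w a x.
  by rewrite RintegralZl//; exact: iw.
have -> : \int[mu]_(x in `]0%R, +oo[) ((a + 1) * C * h x) = (a + 1) * C * 2.
  by rewrite RintegralZl ?Rintegral_expRN_half//; exact: integrable_expRN_half.
rewrite !GammaE /w.
have -> : a + 2 - 1 = a + 1 by ring.
have -> : a + 1 - 1 = a by ring.
set I1 := Rintegral _ _ _; set I0 := Rintegral _ _ _ => H.
have -> : I1 = I1 - (a + 1) * I0 + (a + 1) * C * 2 + (a + 1) * I0 - 2 * ((a + 1) * C).
  by ring.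
by rewrite H; ring.
Unshelve. all: by end_near. Qed.

End gamma_integral.

(** * Wendel's inequality, factorial values and positivity of Gamma *)

Section gamma_wendel.
Context {R : realType}.
Notation mu := (@lebesgue_measure R).
Implicit Types a t x y : R.

Lemma ln_le_sub1 x : 0 < x -> ln x <= x - 1.
Proof.
move=> x0; have := @le_ln1Dx R (x - 1); rewrite [1 + _]addrC subrK; apply.
by rewrite ltrBrDl subrr.
Qed.

(** Weighted AM-GM for t and 1. With c the right-hand side, the bound ln x <= x - 1 is applied at t
    / c and at 1 / c and averaged with weights y and 1 - y; the averaged right-hand sides cancel. *)
Lemma powR_le_lin t y : 0 <= t -> 0 <= y <= 1 -> t `^ y <= 1 - y + y * t.
Proof.
rewrite le_eqVlt => /predU1P[<-|t0] /andP[y0 y1].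
  rewrite mulr0 addr0; have [->|yn0] := eqVneq y 0; first by rewrite powRr0 subr0.
  by rewrite powR0// subr_ge0.
have c0 : 0 < 1 - y + y * t.
  have [->|yn0] := eqVneq y 0; first by rewrite mul0r subr0 addr0.
  by rewrite ltr_wpDl ?subr_ge0// mulr_gt0// lt_neqAle eq_sym yn0.
set c := (X in _ <= X) in c0 *.
rewrite -[leRHS]lnK ?posrE// /powR gt_eqF// ler_expR.
have h1 : ln t - ln c <= t / c - 1.
  by rewrite -ln_div ?posrE// ln_le_sub1// divr_gt0.
have h2 : - ln c <= c^-1 - 1.
  by rewrite -lnV ?posrE// ln_le_sub1// invr_gt0.
have h3 : y * (t / c - 1) + (1 - y) * (c^-1 - 1) = 0.
  by have := gt_eqF c0; rewrite /c => cn0; field; rewrite cn0.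
rewrite -subr_le0 -h3.
have -> : y * ln t - ln c = y * (ln t - ln c) + (1 - y) * - ln c by ring.
by apply: lerD; rewrite ler_wpM2l// subr_ge0.
Qed.

Lemma Gamma1 : Gamma (1 : R) = 1.
Proof.
have iw := @integrable_powR_expRN R 0 (lexx 0).
rewrite GammaE subrr Rintegral_itv_obnd_cbnd//.
rewrite /Rintegral (@ge0_continuous_FTC2y _ _ (fun t => - expR (- t)) 0 0).
- by rewrite /= oppr0 expR0 sub0r opprK.
- by move=> x _; rewrite mulr_ge0 ?powR_ge0 ?expR_ge0.
- apply: continuous_subspaceT => x.
  rewrite (_ : (fun t : R => _) = (fun t => expR (- t))); last first.
    by apply/funext => t; rewrite powRr0 mul1r.
  apply: (@continuous_comp _ _ _ -%R expR); last exact: continuous_expR.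
  exact: opp_continuous.
- by rewrite -oppr0; apply: cvgN; exact: cvgr_expR.
- by move=> x _; apply: ex_derive.
- apply: cvgN; apply: cvg_at_right_filter.
  apply: (@continuous_comp _ _ _ -%R expR); last exact: continuous_expR.
  exact: opp_continuous.
- move=> x _; rewrite derive1E.
  by rewrite derive_val /GRing.scale/= powRr0 mulrN1 opprK mul1r.
Qed.

Lemma Gamma_fact n : Gamma (n%:R + 1) = (n`!)%:R :> R.
Proof.
elim: n => [|n IH]; first by rewrite add0r Gamma1.
have -> : n.+1%:R + 1 = n%:R + 2 :> R by rewrite -natr1; ring.
by rewrite GammaS// IH factS natrM -natr1.
Qed.

(* Wendel's inequality: integrate Young's inequality for [t `^ y] against the
   density defining Gamma. *)
Lemma Gamma_wendel a y : 0 <= a -> 0 <= y <= 1 ->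
  Gamma (a + 1 + y) <= (a + 1) `^ y * Gamma (a + 1).
Proof.
move=> a0 y01; have /andP[y0 y1] := y01.
have a1 : 0 < a + 1 by rewrite ltr_wpDl.
pose w b t := t `^ b * expR (- t).
pose c := (a + 1) `^ y.
have iw b : 0 <= b -> mu.-integrable `]0%R, +oo[ (EFin \o w b).
  exact: integrable_powR_expRN.
have iZ k b : 0 <= b -> mu.-integrable `]0%R, +oo[ (EFin \o (fun t => k * w b t)).
  by move=> b0; apply: eq_integrable (integrableZl _ k (iw _ b0)).
have iZ1 := iZ (c * (1 - y)) _ a0.
have iZ2 := iZ (c * (y / (a + 1))) (a + 1) (ltW a1).
have ID : mu.-integrable `]0%R, +oo[ (EFin \o
    (fun t => c * (1 - y) * w a t + c * (y / (a + 1)) * w (a + 1) t)).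
  by apply: eq_integrable (integrableD _ iZ1 iZ2).
have IZ k b : 0 <= b -> \int[mu]_(t in `]0%R, +oo[) (k * w b t) =
    k * \int[mu]_(t in `]0%R, +oo[) w b t.
  by move=> b0; rewrite RintegralZl//; exact: iw.
have ay0 : 0 <= a + y by rewrite addr_ge0.
have -> : c * Gamma (a + 1) = \int[mu]_(t in `]0%R, +oo[)
    (c * (1 - y) * w a t + c * (y / (a + 1)) * w (a + 1) t).
  rewrite RintegralD// !IZ//; last exact: ltW.
  have Ga : Gamma (a + 1) = \int[mu]_(t in `]0%R, +oo[) w a t.
    by rewrite GammaE; have -> : a + 1 - 1 = a by ring.
  have Gb : (a + 1) * Gamma (a + 1) = \int[mu]_(t in `]0%R, +oo[) w (a + 1) t.
    by rewrite -(GammaS a0) GammaE; have -> : a + 2 - 1 = a + 1 by ring.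
  by rewrite -Gb -Ga; field; rewrite gt_eqF.
rewrite GammaE; have -> : a + 1 + y - 1 = a + y by ring.
apply: le_Rintegral => //; first exact: iw.
move=> t /=; rewrite in_itv/= andbT => t0; rewrite -/(w (a + y) t) /w.
rewrite !powRD ?(gt_eqF t0) ?implybT// powRr1 ?(ltW t0)//.
have -> : c * (1 - y) * (t `^ a * expR (- t)) +
    c * (y / (a + 1)) * (t `^ a * t * expR (- t)) =
    t `^ a * (c * (1 - y + y * (t / (a + 1)))) * expR (- t) by ring.
rewrite ler_wpM2r ?expR_ge0//.
rewrite ler_wpM2l ?powR_ge0//.
have {1}-> : t = (a + 1) * (t / (a + 1)) by field; rewrite gt_eqF.
have td : 0 <= t / (a + 1) by rewrite divr_ge0// ltW.
by rewrite powRM// ?(ltW a1)// ler_wpM2l ?powR_ge0// powR_le_lin.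
Qed.

(** Wendel's inequality bounds the factorial of the next integer by a positive multiple of
    [Gamma (a + 1)], so the integral need not be estimated from below. *)
Lemma Gamma_gt0 a : 0 <= a -> 0 < Gamma (a + 1).
Proof.
move=> a0; pose m := Num.truncn a.
have /andP[ma am] := truncn_itv a0.
have y01 : 0 <= m.+1%:R - a <= 1.
  rewrite subr_ge0 (ltW am)/= lerBlDr -natr1 addrC lerD2l; exact: ma.
have := Gamma_wendel a0 y01.
have -> : a + 1 + (m.+1%:R - a) = m.+1%:R + 1 by ring.
rewrite Gamma_fact => h; have : (0 : R) < (m.+1)`!%:R by rewrite ltr0n fact_gt0.
move=> /lt_le_trans /(_ h); rewrite pmulr_rgt0//.
by rewrite powR_gt0// ltr_wpDl.
Qed.

End gamma_wendel.

(** * Binomial series coefficients *)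

(* [negbin a n] is the coefficient of z^n in (1 - z)^(-a). *)
Definition negbin {R : realType} (a : R) (n : nat) : R :=
  \prod_(i < n) ((a + i%:R) / i.+1%:R).

Section negbin_theory.
Context {R : realType}.
Implicit Types a b : R.

Lemma negbin0 a : negbin a 0 = 1.
Proof. by rewrite /negbin big_ord0. Qed.

Lemma negbinS a n : negbin a n.+1 = negbin a n * ((a + n%:R) / n.+1%:R).
Proof. by rewrite /negbin big_ord_recr. Qed.

Lemma negbin_ge0 a n : 0 <= a -> 0 <= negbin a n.
Proof.
by move=> a0; apply: prodr_ge0 => i _; rewrite divr_ge0// addr_ge0.
Qed.

Lemma negbin_gt0 a n : 0 < a -> 0 < negbin a n.
Proof.
by move=> a0; apply: prodr_gt0 => i _; rewrite divr_gt0// ltr_wpDr.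
Qed.

Lemma negbin1 n : negbin (1 : R) n = 1.
Proof.
apply: big1 => i _.
by rewrite addrC natr1 divff// pnatr_eq0.
Qed.

(** Coefficients of a (1 - z)^(-a-1) = (a + z d/dz) (1 - z)^(-a). *)
Lemma negbin_shift a n : negbin (a + 1) n * a = negbin a n * (a + n%:R).
Proof.
elim: n => [|n IH]; first by rewrite !negbin0 addr0 !mul1r.
rewrite !negbinS mulrAC IH -natr1; have : n%:R + 1 != 0 :> R.
  by rewrite natr1 pnatr_eq0.
by move=> n1; field.
Qed.

(* The identity (1 - z)^(-a) (1 - z)^(-b) = (1 - z)^(-(a + b)). *)
Lemma negbinD a b n :
  \sum_(j < n.+1) negbin a j * negbin b (n - j)%N = negbin (a + b) n.
Proof.
elim: n a b => [|n IH] a b.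
  by rewrite big_ord_recl big_ord0 /= subnn !negbin0 mulr1 addr0.
apply: (@mulIf _ (n.+1%:R)); first by rewrite pnatr_eq0.
(* [D] is d/dz (1 - z)^(-x) = x (1 - z)^(-x-1) on coefficients. Splitting n+1 as j + (n+1-j) below
   is the product rule, which lowers the degree by one while raising a or b; hence the induction
   over all a and b. *)
have D (x : R) (m : nat) : negbin x m.+1 * m.+1%:R = x * negbin (x + 1) m.
  rewrite negbinS -mulrA divfK ?pnatr_eq0//.
  by rewrite -negbin_shift mulrC.
rewrite D mulr_suml.
have -> : \sum_(j < n.+2) negbin a j * negbin b (n.+1 - j)%N * n.+1%:R =
    \sum_(j < n.+2) negbin a j * j%:R * negbin b (n.+1 - j)%N +
    \sum_(j < n.+2) negbin a j * (negbin b (n.+1 - j)%N * (n.+1 - j)%N%:R).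
  rewrite -big_split/=; apply: eq_bigr => j _.
  have jn : (j <= n.+1)%N by rewrite -ltnS.
  by rewrite natrB//; ring.
rewrite big_ord_recl/= mulr0 mul0r add0r.
rewrite [X in _ + X]big_ord_recr/= subnn !mulr0 addr0.
have -> : \sum_(i < n.+1) negbin a (bump 0 i) * (bump 0 i)%:R *
    negbin b (n.+1 - bump 0 i)%N = a * negbin (a + 1 + b) n.
  rewrite -IH mulr_sumr; apply: eq_bigr => j _.
  by rewrite /bump/= add1n D subSS mulrA.
have -> : \sum_(i < n.+1) negbin a i * (negbin b (n.+1 - i)%N * (n.+1 - i)%:R) =
    b * negbin (a + (b + 1)) n.
  rewrite -IH mulr_sumr; apply: eq_bigr => j _.
  have jn : (j <= n)%N by rewrite -ltnS.
  by rewrite subSn// D; ring.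
have -> : a + 1 + b = a + b + 1 by ring.
have -> : a + (b + 1) = a + b + 1 by ring.
by rewrite mulrDl.
Qed.

End negbin_theory.

(** * Dominated convergence of series *)

Section tannery.
Context {R : realType}.
Implicit Types f g : nat -> R.

Lemma cvg_series_dominated f g : (forall k, `|f k| <= g k) ->
  cvgn (series g) -> cvgn (series f).
Proof.
move=> fg cg; apply: normed_cvg.
have g0 k : 0 <= g k by apply: le_trans (fg k).
exact: (@series_le_cvg _ (fun k => `|f k|) _ (fun=> normr_ge0 _) g0 fg cg).
Qed.

Lemma series_tail_dominated f g N : (forall k, `|f k| <= g k) ->
  cvgn (series g) ->
  `|limn (series f) - series f N| <= limn (series g) - series g N.
Proof.
move=> fg cg; have cf := cvg_series_dominated fg cg.
have g0 k : 0 <= g k by apply: le_trans (fg k).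
have H1 : (fun M => `|series f M - series f N|) @ \oo -->
    `|limn (series f) - series f N|.
  by apply: cvg_norm; apply: cvgB => //; exact: cvg_cst.
apply: (cvgr_to_le H1); near=> M.
have NM : (N <= M)%N by near: M; exact: nbhs_infty_ge.
rewrite sub_series NM (le_trans (ler_norm_sum _ _ _))//.
apply: (@le_trans _ _ (series g M - series g N)).
  by rewrite sub_series NM ler_sum.
rewrite lerB//; apply: nondecreasing_cvgn_le => //.
apply/nondecreasing_seqP => m; rewrite -subr_ge0 sub_series leqnSn.
by rewrite sumr_ge0.
Unshelve. all: by end_near. Qed.

Lemma cvg_sum_ord {T : Type} (F : set_system T) {FF : Filter F} n
    (f : nat -> T -> R) (l : nat -> R) :
  (forall k, f k t @[t --> F] --> l k) ->
  \sum_(k < n) f k t @[t --> F] --> \sum_(k < n) l k.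
Proof.
move=> fl; elim: n => [|n IH].
  rewrite (_ : (fun t => _) = cst 0); last by apply/funext => t; rewrite big_ord0.
  by rewrite big_ord0; exact: cvg_cst.
rewrite (_ : (fun t => _) = (fun t => \sum_(k < n) f k t + f n t)).
  by rewrite big_ord_recr; exact: cvgD.
by apply/funext => t; rewrite big_ord_recr.
Qed.

(** Tannery's theorem, for an arbitrary proper filter because it serves three limits: n -> oo in the
    discretisation, alpha -> 1, and delta -> 0 from the right. *)
Lemma tannery {T : Type} (F : set_system T) {FF : ProperFilter F}
    (f : T -> nat -> R) (g l : nat -> R) :
  (\forall t \near F, forall k, `|f t k| <= g k) -> cvgn (series g) ->
  (forall k, f t k @[t --> F] --> l k) ->
  limn (series (f t)) @[t --> F] --> limn (series l).
Proof.
move=> fg cg fl.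
have lg k : `|l k| <= g k.
  apply: (cvgr_to_le (cvg_norm (fl k))).
  by apply: filterS fg => t; apply.
apply/cvgrPdist_le => e e0.
have e3 : 0 < e / 3 by rewrite divr_gt0.
have /cvgrPdist_le /(_ _ e3) [N _ HN] := cg.
have {}HN := HN N (leqnn N).
have SN : series (f t) N @[t --> F] --> series l N.
  rewrite /series/= big_mkord.
  rewrite (_ : (fun t => _) = (fun t => \sum_(k < N) f t k)).
    exact: (@cvg_sum_ord _ _ _ N (fun k t => f t k)).
  by apply/funext => t; rewrite big_mkord.
have /cvgrPdist_le /(_ _ e3) HS := SN.
near=> t.
have ft : forall k, `|f t k| <= g k by near: t.
have h1 := le_trans (series_tail_dominated N ft cg) (ler_norm _).
have h2 := le_trans (series_tail_dominated N lg cg) (ler_norm _).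
have h3 : `|series l N - series (f t) N| <= e / 3 by near: t.
have {}h1 := le_trans h1 HN; have {}h2 := le_trans h2 HN.
have -> : limn (series l) - limn (series (f t)) =
  (limn (series l) - series l N) + (series l N - series (f t) N)
  - (limn (series (f t)) - series (f t) N) by ring.
rewrite (le_trans (ler_normB _ _))//.
have -> : e = e / 3 + e / 3 + e / 3 by field.
by rewrite lerD// (le_trans (ler_normD _ _))// lerD.
Unshelve. all: by end_near. Qed.

Lemma ratio_test (u : nat -> R) (q : R) (N : nat) : 0 <= q < 1 ->
  (forall k, 0 <= u k) -> (forall k, (N <= k)%N -> u k.+1 <= q * u k) ->
  cvgn (series u).
Proof.
move=> /andP[q0 q1] u0 uq.
have H m : u (N + m)%N <= u N * q ^+ m.
  elim: m => [|m IH]; first by rewrite addn0 expr0 mulr1.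
  rewrite addnS exprS mulrCA (le_trans (uq _ (leq_addr _ _)))//.
  by rewrite ler_wpM2l.
have nd : {homo series u : n m / (n <= m)%N >-> n <= m}.
  apply/nondecreasing_seqP => m; rewrite -subr_ge0 sub_series leqnSn.
  by rewrite sumr_ge0.
apply: nondecreasing_is_cvgn => //.
have q1' : 0 < 1 - q by rewrite subr_gt0.
exists (series u N + u N / (1 - q)) => _ [m _ <-] /=.
apply: (@le_trans _ _ (series u (N + m)%N)); first exact/nd/leq_addl.
rewrite -lerBlDl sub_series leq_addr.
rewrite -{1}[N]add0n big_addn addKn.
apply: (@le_trans _ _ (series (geometric (u N) q) m)).
  by apply: ler_sum => k _; rewrite addnC.
rewrite geometric_seriesE ?lt_eqF// ler_wpM2r ?invr_ge0 ?(ltW q1')//.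
by rewrite ler_piMr// gerBl exprn_ge0.
Qed.

End tannery.

(** * The Gauss-Euler limit for Gamma and its monotonicity *)

Section gauss_limit.
Context {R : realType}.
Implicit Types a y : R.

Lemma Gamma_negbin a n : 0 <= a ->
  Gamma (a + 1 + n%:R) = Gamma (a + 1) * negbin (a + 1) n * n`!%:R.
Proof.
move=> a0; elim: n => [|n IH]; first by rewrite addr0 negbin0 !mulr1.
have -> : a + 1 + n.+1%:R = (a + n%:R) + 2 by rewrite -natr1; ring.
rewrite GammaS ?addr_ge0//.
have -> : a + n%:R + 1 = a + 1 + n%:R by ring.
rewrite IH negbinS factS natrM; have : n.+1%:R != 0 :> R by rewrite pnatr_eq0.
by move=> n0; field.
Qed.

(** With N = n+1 the quantity is Gamma(N+1+y) / (N! N^y). Wendel's inequality from N+1 up to N+1+y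
    bounds it above by 1 + 1/N, and from N+1+y up to N+2 below by 1 - 1/N. *)
Lemma negbin_gauss_unit y : 0 <= y <= 1 ->
  negbin (y + 1) n * n%:R `^ (- y) @[n --> \oo] --> (Gamma (y + 1))^-1.
Proof.
move=> y01; have /andP[y0 y1] := y01.
pose r n : R := negbin (y + 1) n * n%:R `^ (- y).
have G0 := Gamma_gt0 y0.
suff H : Gamma (y + 1) * r n @[n --> \oo] --> (1 : R).
  rewrite -[X in _ --> X]mulr1.
  rewrite (_ : (fun n => _) = (fun n => (Gamma (y + 1))^-1 * (Gamma (y + 1) * r n))).
    by apply: cvgMr.
  by apply/funext => n; rewrite mulKf// gt_eqF.
rewrite -cvg_shiftS.
apply: (@squeeze_cvgr _ _ _ _ (fun n => 1 - harmonic n) (fun n => 1 + harmonic n)); last 2 first.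
- by rewrite -[X in _ --> X]subr0; apply: cvgB; [exact: cvg_cst|exact: cvg_harmonic].
- by rewrite -[X in _ --> X]addr0; apply: cvgD; [exact: cvg_cst|exact: cvg_harmonic].
near=> n; rewrite /= /harmonic.
have N0 : (0 : R) < n.+1%:R by [].
set N : R := n.+1%:R in N0 *.
have f0 : (0 : R) < n.+1`!%:R by rewrite ltr0n fact_gt0.
have Ny0 : 0 < N `^ y by exact: powR_gt0.
have E : Gamma (y + 1) * r n.+1 = Gamma (N + 1 + y) / n.+1`!%:R / N `^ y.
  have -> : N + 1 + y = y + 1 + n.+1%:R by rewrite /N; ring.
  rewrite Gamma_negbin// /r powRN -/N.
  by field; rewrite !gt_eqF.
have N10 : 0 <= N + 1 by rewrite addr_ge0// ltW.
rewrite E; apply/andP; split.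
  rewrite (ler_pdivlMr _ _ Ny0) (ler_pdivlMr _ _ f0).
  have y'01 : 0 <= 1 - y <= 1 by rewrite subr_ge0 y1 gerBl.
  have Ny : 0 <= N + y by rewrite addr_ge0// ltW.
  have := Gamma_wendel Ny y'01.
  have -> : N + y + 1 + (1 - y) = n.+2%:R + 1 by rewrite -natr1 /N; ring.
  have -> : N + y + 1 = N + 1 + y by ring.
  rewrite Gamma_fact factS natrM -[n.+2%:R]natr1 -/N => W.
  have Z0 : 0 < (N + 1 + y) `^ (1 - y) by rewrite powR_gt0// ltr_wpDr// ltr_wpDr.
  rewrite -(ler_pM2l Z0); apply: le_trans W.
  rewrite [leLHS](_ : _ = ((N + 1 + y) `^ (1 - y) * N `^ y) * (1 - N^-1) * n.+1`!%:R); last by ring.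
  rewrite ler_wpM2r ?(ltW f0)//.
  (* A crude bound is enough here: both bases are at most N + 2, and (N + 2)(1 - 1/N) <= N + 1. *)
  have le2 : (N + 1 + y) `^ (1 - y) * N `^ y <= N + 2.
    have N2 : 0 < N + 2 by rewrite addr_gt0.
    have -> : N + 2 = (N + 2) `^ (1 - y) * (N + 2) `^ y.
      rewrite -powRD; last by rewrite subrK oner_eq0.
      by rewrite subrK powRr1// ltW.
    have N1y : N + 1 + y <= N + 2 by rewrite -addrA lerD2l lerD2l.
    have N1y0 : 0 <= N + 1 + y by rewrite addr_ge0.
    apply: ler_pM; rewrite ?powR_ge0//; apply: ge0_ler_powR => //;
      rewrite ?nnegrE ?subr_ge0 ?(ltW N0) ?(ltW N2)//.
    by rewrite lerDl.
  have N1 : 0 <= 1 - N^-1.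
    by rewrite subr_ge0 invf_le1// ler1n.
  apply: (le_trans (ler_wpM2r N1 le2)).
  have -> : (N + 2) * (1 - N^-1) = N + 1 - 2 / N by field; rewrite gt_eqF.
  by rewrite gerBl divr_ge0// ltW.
rewrite (ler_pdivrMr _ _ Ny0) (ler_pdivrMr _ _ f0).
have := Gamma_wendel (ltW N0) y01; rewrite [in X in _ <= X]Gamma_fact => /le_trans; apply.
rewrite ler_wpM2r ?(ltW f0)//.
have -> : N + 1 = (1 + N^-1) * N by field; rewrite gt_eqF.
have i0 : 0 <= N^-1 by rewrite invr_ge0 ltW.
rewrite powRM ?addr_ge0 ?(ltW N0)// ler_wpM2r ?(ltW Ny0)//.
by apply: ler1_powR => //; rewrite lerDl.
Unshelve. all: by end_near. Qed.

(* Euler's limit formula for Gamma; the functional equation reduces it to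
   exponents in [0, 1], where Wendel's inequality gives a squeeze. *)
Lemma negbin_gauss a : 0 <= a ->
  negbin (a + 1) n * n%:R `^ (- a) @[n --> \oo] --> (Gamma (a + 1))^-1.
Proof.
move=> a0; have [y [m [-> y01]]] : exists y m, a = y + m%:R /\ 0 <= y <= 1.
  exists (a - (Num.truncn a)%:R), (Num.truncn a); rewrite subrK; split=> //.
  have /andP[ma am] := truncn_itv a0.
  by rewrite subr_ge0 ma/= lerBlDr addrC natr1 ltW.
have /andP[y0 y1] := y01.
elim: m => [|m IH]; first by rewrite addr0; exact: negbin_gauss_unit.
rewrite -natr1 addrA; have : 0 <= y + m%:R by rewrite addr_ge0.
move: (y + m%:R) IH => b IH b0.
have -> : b + 1 + 1 = b + 2 by ring.
rewrite GammaS// invfM mulrC.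
have b1 : 0 < b + 1 by rewrite ltr_wpDl.
have H : ((b + 1) * harmonic n + 1) / (b + 1) @[n --> \oo] --> (b + 1)^-1.
  rewrite -[X in _ --> X]mul1r; apply: cvgMl.
  rewrite -[X in _ --> X]add0r; apply: cvgD; last exact: cvg_cst.
  rewrite -[X in _ --> X](mulr0 (b + 1)); apply: cvgMr; exact: cvg_harmonic.
rewrite -cvg_shiftS; rewrite -cvg_shiftS in IH.
apply: cvg_trans (cvgM IH H); apply: near_eq_cvg; near=> n.
rewrite /= /harmonic.
have n0 : (0 : R) < n.+1%:R by [].
have E := negbin_shift (b + 1) n.+1.
have -> : b + 2 = b + 1 + 1 by ring.
have -> : negbin (b + 1 + 1) n.+1 = negbin (b + 1) n.+1 * (b + 1 + n.+1%:R) / (b + 1).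
  by rewrite -E mulfK// gt_eqF.
have -> : n.+1%:R `^ (- (b + 1)) = n.+1%:R `^ (- b) / n.+1%:R.
  by rewrite !powRN powRD ?gt_eqF ?implybT// powRr1 ?ltW// invfM.
move: n0; move: (n.+1%:R : R) (negbin _ _) => N c n0.
by have nn := gt_eqF n0; have bb := gt_eqF b1; field; rewrite nn bb.
Unshelve. all: by end_near. Qed.

(** Turns the Gauss-Euler limit into an inequality at every finite n and provides majorants
    independent of n. The ratio of consecutive terms is (1 + a/(j+1)) (j/(j+1))^a, at most 1 by 1 +
    x <= exp x and ln x <= x - 1. *)
Lemma negbin_powR_noninc a n m : 0 <= a -> (0 < n)%N -> (n <= m)%N ->
  negbin (a + 1) m * m%:R `^ (- a) <= negbin (a + 1) n * n%:R `^ (- a).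
Proof.
move=> a0 n0 /subnK <-; elim: (m - n)%N => [//|k IH]; apply: le_trans IH.
rewrite addSn; set j := (k + n)%N.
have j0 : (0 : R) < j%:R by rewrite ltr0n /j addn_gt0 n0 orbT.
rewrite negbinS -mulrA ler_wpM2l ?negbin_ge0 ?addr_ge0//.
have J0 : (0 : R) < j.+1%:R by [].
rewrite !powRN (ler_pdivrMr _ _ (powR_gt0 _ J0)) [leRHS]mulrC.
rewrite (ler_pdivlMr _ _ (powR_gt0 _ j0)) /powR !gt_eqF//.
have -> : (a + 1 + j%:R) / j.+1%:R = 1 + a / j.+1%:R.
  by rewrite -addrA (addrC 1 j%:R) natr1 mulrDl divff ?gt_eqF// addrC.
apply: (@le_trans _ _ (expR (a / j.+1%:R) * expR (a * ln j%:R))).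
  by rewrite ler_wpM2r ?expR_ge0// expR_ge1Dx.
rewrite -expRD ler_expR -mulrDr ler_wpM2l// -lerBrDr -opprB lerNr.
rewrite -ln_div ?posrE//; apply: le_trans (ln_le_sub1 _) _; first by rewrite divr_gt0.
rewrite -[j%:R](addrK 1) natr1 mulrBl divff ?gt_eqF// mul1r.
by rewrite addrAC subrr add0r.
Qed.

End gauss_limit.

(** * Discrete fractional relaxation *)

Section relaxation.
Context {R : realType}.
Implicit Types (a b q alpha eps : R).

Lemma ler_negbin a b n : 0 <= a -> a <= b -> negbin a n <= negbin b n.
Proof.
move=> a0 ab; apply: ler_prod => i _.
by rewrite divr_ge0 ?addr_ge0//= ler_wpM2r ?invr_ge0// lerD2r.
Qed.

(** The factor [negbin (k + 1) n] is a polynomial in k of degree n, so the ratio q (1 + n/(k+1))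
    falls below the midpoint q' of q and 1 once k+1 >= q n / (q' - q). *)
Lemma cvg_negbin_pow q n : 0 <= q < 1 ->
  cvgn (series (fun k => q ^+ k * negbin (k%:R + 1) n)).
Proof.
move=> /andP[q0 q1]; pose q' := (1 + q) / 2.
have q'01 : 0 <= q' < 1 by rewrite /q'; lra.
have qq : 0 < q' - q by rewrite /q'; lra.
pose N := (Num.truncn (q * n%:R / (q' - q))).+1.
apply: (@ratio_test _ _ q' N) => // k.
  by rewrite mulr_ge0 ?exprn_ge0// negbin_ge0// addr_ge0.
move=> Nk; have k0 : (0 : R) < k.+1%:R by [].
have E := negbin_shift (k.+1%:R : R) n; rewrite [k%:R + 1]natr1.
have -> : negbin (k.+1%:R + 1) n = negbin k.+1%:R n * (k.+1%:R + n%:R) / k.+1%:R :> R.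
  by rewrite -E mulfK// gt_eqF.
have -> : q ^+ k.+1 * (negbin k.+1%:R n * (k.+1%:R + n%:R) / k.+1%:R) =
  (q * (k.+1%:R + n%:R) / k.+1%:R) * (q ^+ k * negbin k.+1%:R n).
  by rewrite exprS; ring.
rewrite ler_wpM2r ?mulr_ge0 ?exprn_ge0 ?negbin_ge0//.
rewrite ler_pdivrMr// mulrDr -lerBrDl -mulrBl -ler_pdivrMl// mulrC.
have := real_truncnS_gt (num_real (q * n%:R / (q' - q))).
move=> /ltW /le_trans; apply; rewrite ler_nat.
exact: leq_trans Nk (leqnSn _).
Qed.

(* The coefficient of z^n in (1 - z)^-1 / (1 + eps (1 - z)^(-alpha)): the
   implicit Gruenwald-Letnikov discretisation of the fractional relaxation
   equation whose solution is the Mittag-Leffler function. *)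
Definition relax alpha eps n : R :=
  limn (series (fun k => (- eps) ^+ k * negbin (k%:R * alpha + 1) n)).

Lemma relax_term_le alpha eps n k : 0 < alpha < 1 -> 0 < eps ->
  `|(- eps) ^+ k * negbin (k%:R * alpha + 1) n| <=
  eps ^+ k * negbin (k%:R + 1) n.
Proof.
move=> /andP[a0 a1] e0.
have ka : 0 <= k%:R * alpha by rewrite mulr_ge0// ltW.
rewrite normrM normrX normrN (gtr0_norm e0) ler_wpM2l ?exprn_ge0 ?(ltW e0)//.
rewrite ger0_norm ?negbin_ge0 ?addr_ge0// ler_negbin ?addr_ge0// lerD2r.
by rewrite ler_piMr// ltW.
Qed.

Lemma cvg_relax alpha eps n : 0 < alpha < 1 -> 0 < eps < 1 ->
  series (fun k => (- eps) ^+ k * negbin (k%:R * alpha + 1) n) @ \oo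
    --> relax alpha eps n.
Proof.
move=> a01 /andP[e0 e1]; apply: cvg_series_dominated.
  by move=> k; exact: relax_term_le.
by apply: cvg_negbin_pow; rewrite e1 ltW.
Qed.

(** The generating function identity is checked on partial sums: convolution with the coefficients
    of (1 - z)^alpha lowers k alpha + 1 by alpha, so the partial sum up to K+1 becomes the k = 0
    term minus eps times the partial sum up to K. Then K -> oo. *)
Lemma relax_recursion alpha eps n : 0 < alpha < 1 -> 0 < eps < 1 ->
  (1 + eps) * relax alpha eps n = negbin (1 - alpha) n +
    \sum_(j < n) - negbin (- alpha) j.+1 * relax alpha eps (n - j.+1)%N.
Proof.
move=> a01 e01.
pose t k m : R := (- eps) ^+ k * negbin (k%:R * alpha + 1) m.
have tc m : series (t ^~ m) @ \oo --> relax alpha eps m by exact: cvg_relax.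
have conv K : \sum_(j < n.+1) negbin (- alpha) j * series (t ^~ (n - j)%N) K.+1 =
    negbin (1 - alpha) n - eps * series (t ^~ n) K.
  transitivity (\sum_(k < K.+1) (- eps) ^+ k * negbin (k%:R * alpha + 1 - alpha) n).
    rewrite /series/=; under eq_bigr do rewrite big_mkord mulr_sumr.
    rewrite exchange_big/=; apply: eq_bigr => k _.
    rewrite [k%:R * _ + 1 - alpha]addrC -negbinD mulr_sumr.
    by apply: eq_bigr => j _; rewrite /t; ring.
  rewrite big_ord_recl expr0 mul1r mul0r add0r; congr (_ + _).
  rewrite /series/= big_mkord mulr_sumr -sumrN; apply: eq_bigr => k _.
  rewrite /t /bump/= add1n exprS -natr1.
  have -> : (k%:R + 1) * alpha + 1 - alpha = k%:R * alpha + 1 by ring.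
  by ring.
have L1 : \sum_(j < n.+1) negbin (- alpha) j * series (t ^~ (n - j)%N) K.+1
    @[K --> \oo] --> \sum_(j < n.+1) negbin (- alpha) j * relax alpha eps (n - j)%N.
  apply: (@cvg_sum_ord _ _ _ _ n.+1 (fun j K => negbin (- alpha) j * series (t ^~ (n - j)%N) K.+1)
    (fun j => negbin (- alpha) j * relax alpha eps (n - j)%N)) => j.
  by apply: cvgMr; rewrite (cvg_shiftS (series (t ^~ (n - j)%N))); exact: tc.
have L2 : negbin (1 - alpha) n - eps * series (t ^~ n) K @[K --> \oo] -->
    negbin (1 - alpha) n - eps * relax alpha eps n.
  by apply: cvgB; [exact: cvg_cst|apply: cvgMr; exact: tc].
have : \sum_(j < n.+1) negbin (- alpha) j * relax alpha eps (n - j)%N =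
    negbin (1 - alpha) n - eps * relax alpha eps n.
  by apply: cvg_unique L1 _ => //; rewrite (funext conv).
rewrite big_ord_recl /= subn0 negbin0 mul1r => E.
rewrite mulrDl mul1r.
rewrite -[X in X + _](addrK (\sum_(i < n) negbin (- alpha) (bump 0 i) *
  relax alpha eps (n - bump 0 i))) E.
rewrite -sumrN addrAC subrK; congr (_ + _); apply: eq_bigr => j _.
by rewrite /bump/= add1n mulNr.
Qed.

(** Only the factor with i = 0, namely - alpha, is negative. This sign is what makes the recursion
    monotone. *)
Lemma negbinN_le0 alpha j : 0 < alpha < 1 -> negbin (- alpha) j.+1 <= 0.
Proof.
move=> /andP[a0 a1]; rewrite /negbin big_ord_recl/= addr0 divr1.
rewrite nmulr_rle0 ?oppr_lt0// prodr_ge0// => i _.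
rewrite divr_ge0// /bump/= add1n addrC subr_ge0.
by apply: le_trans (ltW a1) _; rewrite ler1n.
Qed.

(** All coefficients of (1 - z)^(-1) are 1, so multiplying (1 - z)^alpha by it forms the partial
    sums, which are the coefficients of (1 - z)^(alpha - 1). *)
Lemma negbinN_sum alpha n :
  negbin (1 - alpha) n + \sum_(j < n) - negbin (- alpha) j.+1 = 1.
Proof.
rewrite addrC [1 - alpha]addrC -negbinD sumrN big_ord_recl/= negbin0 !negbin1 mulr1.
rewrite addrCA; under [X in _ + (_ + X)]eq_bigr do rewrite negbin1 mulr1 /bump/= add1n.
by rewrite addNr addr0.
Qed.

(** Discrete comparison principle: with nonnegative weights on earlier values, a subsolution of the
    recursion stays below its solution. *)
Lemma relax_ge alpha eps (v : nat -> R) : 0 < alpha < 1 -> 0 < eps < 1 ->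
  (forall n, (1 + eps) * v n <= negbin (1 - alpha) n +
    \sum_(j < n) - negbin (- alpha) j.+1 * v (n - j.+1)%N) ->
  forall n, v n <= relax alpha eps n.
Proof.
move=> a01 e01 H n; have /andP[e0 e1] := e01.
have [m] := ubnP n; elim: m n => // m IH n; rewrite ltnS => nm.
have e10 : 0 < 1 + eps by rewrite addr_gt0.
rewrite -(ler_pM2l e10) relax_recursion//; apply: le_trans (H n) _.
rewrite lerD2l; apply: ler_sum => j _.
rewrite ler_wpM2l ?oppr_ge0 ?negbinN_le0// IH//.
by apply: leq_trans nm; rewrite ltn_subrL (leq_ltn_trans _ (ltn_ord j)).
Qed.

(** Replacing every past value by the current one turns the recursion into (1 + eps) v = d + (1 - d)
    v, solved by v = d / (eps + d). As d is nonincreasing in n, so is this v, and past values are at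
    least the current one: v is a subsolution. *)
Lemma relax_ge_rational alpha eps n : 0 < alpha < 1 -> 0 < eps < 1 ->
  negbin (1 - alpha) n / (eps + negbin (1 - alpha) n) <= relax alpha eps n.
Proof.
move=> a01 e01; have /andP[a0 a1] := a01; have /andP[e0 e1] := e01.
pose d m := negbin (1 - alpha) m.
have d0 m : 0 < d m by rewrite negbin_gt0// subr_gt0.
have dn m k : (m <= k)%N -> d k <= d m.
  move=> /subnK <-; elim: (k - m)%N => // i IHi; apply: le_trans IHi.
  rewrite addSn {1}/d negbinS ler_piMr ?(ltW (d0 _))// ler_pdivrMr// mul1r.
  by rewrite -natr1; lra.
apply: (relax_ge (v := fun m => d m / (eps + d m))) => // {}n.
have ed m : 0 < eps + d m by rewrite addr_gt0.
apply: (@le_trans _ _ (d n + (\sum_(j < n) - negbin (- alpha) j.+1) * (d n / (eps + d n)))).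
  have -> : \sum_(j < n) - negbin (- alpha) j.+1 = 1 - d n.
    by apply/eqP; rewrite eq_sym subr_eq addrC negbinN_sum.
  have edn := gt_eqF (ed n).
  by rewrite le_eqVlt; apply/orP; left; apply/eqP; field; rewrite edn.
rewrite lerD2l mulr_suml; apply: ler_sum => j _.
rewrite ler_wpM2l ?oppr_ge0 ?negbinN_le0//.
have mono m : d n <= d m -> d n / (eps + d n) <= d m / (eps + d m).
  move=> nm; rewrite ler_pdivrMr// mulrAC ler_pdivlMr// !mulrDr [d n * d m]mulrC.
  by rewrite lerD2r ler_pM2r.
by apply: mono; rewrite dn// leq_subr.
Qed.

(** The sequence m solves the recursion without damping, m_n = 1 + sum of b_j m_(n-j-1), because (1
    - z)^alpha (1 - z)^(-alpha-1) = (1 - z)^(-1). Convexity of exp then makes exp(- eps m) a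
    subsolution. *)
Lemma relax_ge_exp alpha eps n : 0 < alpha < 1 -> 0 < eps < 1 ->
  expR (- (eps * negbin (alpha + 1) n)) <= relax alpha eps n.
Proof.
move=> a01 e01; have /andP[a0 a1] := a01; have /andP[e0 e1] := e01.
pose m k := negbin (alpha + 1) k.
apply: (relax_ge (v := fun k => expR (- (eps * m k)))) => // {}n.
pose b j := - negbin (- alpha) j.+1.
have mE : m n = 1 + \sum_(j < n) b j * m (n - j.+1)%N.
  have := negbinD (- alpha) (alpha + 1) n.
  have -> : - alpha + (alpha + 1) = 1 by ring.
  rewrite negbin1 big_ord_recl/= subn0 negbin0 mul1r => <-.
  rewrite -addrA -big_split/= big1 ?addr0// => j _.
  by rewrite /bump/= add1n /b /m mulNr subrr.
(* c is the mean of 0 and the exponents - eps m_(n-j-1) under the weights of the recursion, which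
   sum to 1. Jensen's inequality, by the tangent of exp at c, bounds the right-hand side below by
   exp c = exp(eps) exp(- eps m_n). *)
pose c := - (eps * (m n - 1)).
apply: (@le_trans _ _ (expR c)).
  have -> : c = eps + - (eps * m n) by rewrite /c; ring.
  by rewrite expRD ler_wpM2r ?expR_ge0// expR_ge1Dx.
have tangent y : expR c * (1 + y - c) <= expR y.
  have -> : expR y = expR c * expR (y - c) by rewrite -expRD addrC subrK.
  rewrite ler_wpM2l ?expR_ge0//.
  by rewrite -addrA expR_ge1Dx.
have d0 : 0 <= negbin (1 - alpha) n by rewrite negbin_ge0// subr_ge0 ltW.
have tangent0 : expR c * (1 - c) <= 1.
  by have := tangent 0; rewrite expR0 addr0.
apply: (@le_trans _ _ (negbin (1 - alpha) n * (expR c * (1 - c)) +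
    \sum_(j < n) b j * (expR c * (1 + - (eps * m (n - j.+1)%N) - c)))).
  rewrite le_eqVlt; apply/orP; left; apply/eqP.
  have -> : \sum_(j < n) b j * (expR c * (1 + - (eps * m (n - j.+1)%N) - c)) =
    expR c * ((1 - c) * (\sum_(j < n) b j) - eps * \sum_(j < n) b j * m (n - j.+1)%N).
    rewrite !mulr_sumr -sumrN -big_split/= mulr_sumr; apply: eq_bigr => j _.
    by ring.
  have -> : \sum_(j < n) b j * m (n - j.+1)%N = m n - 1.
    by rewrite mE addrAC subrr add0r.
  have -> : \sum_(j < n) b j = 1 - negbin (1 - alpha) n.
    by apply/eqP; rewrite eq_sym subr_eq addrC negbinN_sum.
  by rewrite /c; ring.
apply: lerD; first by rewrite ler_piMr.
by apply: ler_sum => j _; rewrite ler_wpM2l ?oppr_ge0 ?negbinN_le0.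
Qed.

End relaxation.

(** * The Mittag-Leffler function *)

Section mittag_leffler_bounds.
Context {R : realType}.
Implicit Types (a b x lambda T alpha : R).

Lemma powR_exprn a b k : (a `^ b) ^+ k = a `^ (k%:R * b).
Proof. by rewrite -powR_mulrn ?powR_ge0// -powRrM mulrC. Qed.

Lemma Gamma_inv_le a n : 0 <= a -> (0 < n)%N ->
  (Gamma (a + 1))^-1 <= negbin (a + 1) n * n%:R `^ (- a).
Proof.
move=> a0 n0; apply: (cvgr_to_le (negbin_gauss a0)).
by near=> m; apply: negbin_powR_noninc => //; near: m; exact: nbhs_infty_ge.
Unshelve. all: by end_near. Qed.

(** In the induction step, weighted AM-GM at t = (n+1)/(n+2) gives exactly the next factor: 1 -
    alpha + alpha t = (n+2-alpha)/(n+2). The power n^(-alpha) is that of eps = x n^(-alpha), so n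
    cancels in d / (eps + d). *)
Lemma negbin1B_ge alpha n : 0 < alpha < 1 ->
  (1 - alpha) * n.+1%:R `^ (- alpha) <= negbin (1 - alpha) n.+1.
Proof.
move=> /andP[a0 a1]; elim: n => [|n IH].
  by rewrite powR1 mulr1 negbinS negbin0 mul1r addr0 divr1.
rewrite negbinS; apply: le_trans (ler_wpM2r _ IH); last first.
  by rewrite divr_ge0// addr_ge0// subr_ge0 ltW.
rewrite -mulrA ler_wpM2l ?subr_ge0 ?(ltW a1)//.
have n1 : (0 : R) < n.+1%:R by [].
have n2 : (0 : R) < n.+2%:R by [].
have t0 : (0 : R) <= n.+1%:R / n.+2%:R by rewrite divr_ge0.
have a01 : 0 <= alpha <= 1 by rewrite !ltW.
have := powR_le_lin t0 a01.
have -> : (n.+1%:R / n.+2%:R) `^ alpha = n.+1%:R `^ alpha * n.+2%:R `^ (- alpha) :> R.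
  by rewrite powRM ?invr_ge0// -powR_inv1// -powRrM mulN1r.
move=> H.
rewrite [n.+1%:R `^ _]powRN ler_pdivlMl ?powR_gt0//; apply: le_trans H _.
rewrite le_eqVlt; apply/orP; left; apply/eqP.
move: n2; rewrite -[n.+2%:R]natr1; move: (n.+1%:R : R) => N N2.
by have NN := gt_eqF N2; field; rewrite NN.
Qed.

Lemma mittag_leffler1E alpha z : mittag_leffler alpha 1 z =
  limn (series (fun k => z ^+ k * (Gamma (k%:R * alpha + 1))^-1)).
Proof.
have E k : z ^+ k / Gamma (alpha * k%:R + 1) = z ^+ k * (Gamma (k%:R * alpha + 1))^-1.
  by rewrite (mulrC alpha).
by rewrite /mittag_leffler (funext E).
Qed.

(** Termwise this is the Gauss-Euler limit. By monotonicity every term with n >= N is dominated by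
    the one at N, and N is taken with x < N^alpha so that this majorant is summable. *)
Lemma relax_cvg_ML alpha x : 0 < alpha < 1 -> 0 < x ->
  relax alpha (x / n%:R `^ alpha) n @[n --> \oo] --> mittag_leffler alpha 1 (- x).
Proof.
move=> a01 x0; have /andP[a0 a1] := a01; rewrite mittag_leffler1E.
have [N [N0 Nx]] : exists N : nat, (0 < N)%N /\ x < N%:R `^ alpha.
  pose N := (Num.truncn (x `^ alpha^-1)).+1; exists N; split => //.
  have xN := real_truncnS_gt (num_real (x `^ alpha^-1)).
  have -> : x = (x `^ alpha^-1) `^ alpha.
    by rewrite -powRrM mulVf ?gt_eqF// powRr1// ltW.
  by apply: gt0_ltr_powR; rewrite ?nnegrE ?powR_ge0.
have NR : (0 : R) < N%:R by rewrite ltr0n.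
have ka k : 0 <= k%:R * alpha by rewrite mulr_ge0// ltW.
have E n k : (0 < n)%N -> (- (x / n%:R `^ alpha)) ^+ k * negbin (k%:R * alpha + 1) n =
    (- x) ^+ k * (negbin (k%:R * alpha + 1) n * n%:R `^ (- (k%:R * alpha))).
  move=> n0; have nR : (0 : R) < n%:R by rewrite ltr0n.
  rewrite -mulNr exprMn exprVn powR_exprn powRN.
  by ring.
apply: (@tannery _ _ _ _ _ (fun k => (x / N%:R `^ alpha) ^+ k * negbin (k%:R + 1) N)).
- near=> n => k.
  have Nn : (N <= n)%N by near: n; exact: nbhs_infty_ge.
  rewrite E ?(leq_trans N0)// normrM normrX normrN (gtr0_norm x0) ger0_norm; last first.
    by rewrite mulr_ge0 ?powR_ge0// negbin_ge0// addr_ge0.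
  apply: (@le_trans _ _ (x ^+ k * (negbin (k%:R * alpha + 1) N * N%:R `^ (- (k%:R * alpha))))).
    by rewrite ler_wpM2l ?exprn_ge0 ?(ltW x0)// negbin_powR_noninc.
  rewrite exprMn exprVn powR_exprn powRN -mulrA.
  rewrite ler_wpM2l ?exprn_ge0 ?(ltW x0)// mulrC ler_wpM2l ?invr_ge0 ?powR_ge0//.
  by rewrite ler_negbin ?addr_ge0// lerD2r ler_piMr// ltW.
- apply: cvg_negbin_pow; rewrite divr_ge0 ?powR_ge0 ?(ltW x0)//=.
  by rewrite ltr_pdivrMr ?mul1r// powR_gt0.
- move=> k.
  have : (- x) ^+ k * (negbin (k%:R * alpha + 1) n * n%:R `^ (- (k%:R * alpha)))
      @[n --> \oo] --> (- x) ^+ k * (Gamma (k%:R * alpha + 1))^-1.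
    by apply: cvgMr; exact: negbin_gauss.
  apply: cvg_trans; apply: near_eq_cvg; near=> n.
  by rewrite E//; near: n; exact: nbhs_infty_gt.
Unshelve. all: by end_near. Qed.

Lemma near_relax_step alpha x : 0 < alpha -> 0 < x ->
  \forall n \near \oo, (0 < n)%N /\ 0 < x / n%:R `^ alpha < 1.
Proof.
move=> a0 x0; near=> n.
have n0 : (0 < n)%N by near: n; exact: nbhs_infty_gt.
have nR : (0 : R) < n%:R by rewrite ltr0n.
split=> //; rewrite divr_gt0 ?powR_gt0//= ltr_pdivrMr ?powR_gt0// mul1r.
have -> : x = (x `^ alpha^-1) `^ alpha.
  by rewrite -powRrM mulVf ?gt_eqF// powRr1// ltW.
apply: gt0_ltr_powR; rewrite ?nnegrE ?powR_ge0//.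
by near: n; exact: nbhs_infty_gtr.
Unshelve. all: by end_near. Qed.

Lemma mittag_leffler_ge_rational alpha x : 0 < alpha < 1 -> 0 < x ->
  (1 - alpha) / (x + (1 - alpha)) <= mittag_leffler alpha 1 (- x).
Proof.
move=> a01 x0; have /andP[a0 a1] := a01.
apply: (cvgr_to_ge (relax_cvg_ML a01 x0)).
near=> n; have [n0 e01] : (0 < n)%N /\ 0 < x / n%:R `^ alpha < 1.
  by near: n; exact: near_relax_step.
apply: le_trans (relax_ge_rational n a01 e01).
have nR : (0 : R) < n%:R by rewrite ltr0n.
have := negbin1B_ge n.-1 a01; rewrite prednK// powRN.
set d := negbin _ _; set w := n%:R `^ alpha in e01 *; move=> dn.
have w0 : 0 < w by rewrite powR_gt0.
have b0 : 0 < 1 - alpha by rewrite subr_gt0.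
have d0 : 0 < d by apply: lt_le_trans dn; rewrite divr_gt0.
have p1 : 0 < x + (1 - alpha) by rewrite addr_gt0.
have p2 : 0 < x / w + d by rewrite addr_gt0// divr_gt0.
rewrite (ler_pdivrMr _ _ p1) mulrAC (ler_pdivlMr _ _ p2).
rewrite mulrDr [leRHS]mulrDr [d * (1 - _)]mulrC lerD2r mulrCA [leRHS]mulrC.
by rewrite ler_wpM2l// ltW.
Unshelve. all: by end_near. Qed.

Lemma mittag_leffler_ge_exp alpha x : 0 < alpha < 1 -> 0 < x ->
  expR (- (x / Gamma (alpha + 1))) <= mittag_leffler alpha 1 (- x).
Proof.
move=> a01 x0; have /andP[a0 a1] := a01.
have L : expR (- (x * (negbin (alpha + 1) n * n%:R `^ (- alpha)))) @[n --> \oo] -->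
    expR (- (x / Gamma (alpha + 1))).
  apply: continuous_cvg; first exact: continuous_expR.
  by apply: cvgN; apply: cvgMr; apply: negbin_gauss; exact: ltW.
apply: (ler_cvg_to L (relax_cvg_ML a01 x0)).
near=> n; have [n0 e01] : (0 < n)%N /\ 0 < x / n%:R `^ alpha < 1.
  by near: n; exact: near_relax_step.
apply: le_trans (relax_ge_exp n a01 e01).
by rewrite ler_expR lerN2 powRN mulrAC -mulrA.
Unshelve. all: by end_near. Qed.

Lemma mittag_leffler_gt0 alpha x : 0 < alpha < 1 -> 0 < x ->
  0 < mittag_leffler alpha 1 (- x).
Proof.
by move=> a01 x0; apply: lt_le_trans (mittag_leffler_ge_exp a01 x0); exact: expR_gt0.
Qed.

(** Wendel's inequality from alpha + 1 up to 2, followed by AM-GM, gives 1 + alpha - alpha^2, which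
    is 2 - alpha minus (1 - alpha)^2. The bound has the right value 1 at alpha = 1, so the error is
    of order 1 - alpha. *)
Lemma Gamma_inv_le_lin alpha : 0 < alpha < 1 ->
  (Gamma (alpha + 1))^-1 <= 2 - alpha.
Proof.
move=> /andP[a0 a1]; have G0 := Gamma_gt0 (ltW a0).
have y01 : 0 <= 1 - alpha <= 1 by rewrite subr_ge0 (ltW a1) gerBl ltW.
have := Gamma_wendel (ltW a0) y01.
have -> : alpha + 1 + (1 - alpha) = 1%:R + 1 by ring.
rewrite Gamma_fact -ler_pdivrMr// mul1r => /le_trans; apply.
have a10 : 0 <= alpha + 1 by rewrite addr_ge0// ltW.
apply: le_trans (powR_le_lin a10 y01) _.
by have := sqr_ge0 (1 - alpha); nra.
Qed.

(** T^alpha <= 1 - alpha + alpha T and 1 / Gamma(alpha + 1) <= 2 - alpha have product at most T + 2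
    (1 - alpha), so compared with exp(- lambda T) only exp(- 2 lambda (1 - alpha)) is lost. *)
Lemma mittag_leffler_ge alpha lambda T : 0 < alpha < 1 -> 0 < lambda -> 0 < T ->
  expR (- (lambda * T) - 2 * (lambda * (1 - alpha))) <=
  mittag_leffler alpha 1 (- lambda * T `^ alpha).
Proof.
move=> a01 l0 T0; have /andP[a0 a1] := a01.
have P0 : 0 < T `^ alpha by exact: powR_gt0.
rewrite mulNr; apply: le_trans (mittag_leffler_ge_exp a01 _); last exact: mulr_gt0.
rewrite ler_expR -opprD lerN2 -mulrA.
have -> : lambda * T + 2 * (lambda * (1 - alpha)) = lambda * (T + 2 * (1 - alpha)) by ring.
rewrite ler_wpM2l ?(ltW l0)//.
have a01' : 0 <= alpha <= 1 by rewrite !ltW.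
have H1 := powR_le_lin (ltW T0) a01'.
have H2 := Gamma_inv_le_lin a01.
apply: (@le_trans _ _ ((1 - alpha + alpha * T) * (2 - alpha))).
  apply: ler_pM => //; first exact: ltW.
  by rewrite invr_ge0 ltW// Gamma_gt0// ltW.
have -> : (1 - alpha + alpha * T) * (2 - alpha) =
  T + 2 * (1 - alpha) - (alpha * (1 - alpha) + T * (1 - alpha) ^+ 2) by ring.
by rewrite gerBl addr_ge0// mulr_ge0 ?sqr_ge0 ?subr_ge0// ltW.
Qed.

(** For k >= 1 and k (1 - alpha) <= 1 the argument k alpha + 1 lies between k and k + 1, and
    Wendel's inequality on either side squeezes 1 / Gamma between 1 / k! and a quantity tending to
    it. *)
Lemma cvg_Gamma_alpha {U : Type} (F : set_system U) {FF : ProperFilter F}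
    (al : U -> R) (k : nat) :
  (\forall t \near F, 0 < al t < 1) -> al t @[t --> F] --> (1 : R) ->
  (Gamma (k%:R * al t + 1))^-1 @[t --> F] --> (k`!%:R : R)^-1.
Proof.
move=> al01 al1; case: k => [|k].
  rewrite (_ : (fun t => _) = cst (0`!%:R)^-1); first exact: cvg_cst.
  by apply/funext => t; rewrite mul0r add0r Gamma1.
have f0 : (0 : R) < k.+1`!%:R by rewrite ltr0n fact_gt0.
have L : (1 + k.+1%:R * (1 - al t) * k.+1%:R) / k.+1`!%:R @[t --> F] -->
    (k.+1`!%:R : R)^-1.
  rewrite -[X in _ --> X]mul1r; apply: cvgMl.
  rewrite -[X in _ --> X](_ : 1 + k.+1%:R * (1 - 1) * k.+1%:R = 1 :> R); last first.
    by rewrite subrr mulr0 mul0r addr0.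
  apply: cvgD; first exact: cvg_cst.
  by apply: cvgMl; apply: cvgMr; apply: cvgB => //; exact: cvg_cst.
apply: (squeeze_cvgr _ (cvg_cst _) L).
near=> t.
have /andP[a0 a1] : 0 < al t < 1 by near: t.
have y1 : k.+1%:R * (1 - al t) <= 1.
  suff : 1 - k.+1%:R^-1 < al t.
    by move=> /ltW h; rewrite -ler_pdivlMl// mulr1 lerBlDr addrC -lerBlDr.
  near: t; apply: (cvgr_gt _ al1).
  by rewrite gtrBl invr_gt0.
set y := k.+1%:R * (1 - al t) in y1 *.
have y01 : 0 <= y <= 1 by rewrite y1 andbT mulr_ge0// subr_ge0 ltW.
have /andP[y0 _] := y01.
have y'01 : 0 <= 1 - y <= 1 by rewrite subr_ge0 y1 gerBl.
have ka : 0 <= k.+1%:R * al t by rewrite mulr_ge0// ltW.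
have G0 := Gamma_gt0 ka.
have W1 := Gamma_wendel ka y01.
have W2 := Gamma_wendel (ler0n R k) y'01.
have e1 : k.+1%:R * al t + 1 + y = k.+1%:R + 1 by rewrite /y; ring.
have e2 : k%:R + 1 + (1 - y) = k.+1%:R * al t + 1 :> R by rewrite /y natr1; ring.
rewrite e1 !Gamma_fact in W1; rewrite e2 Gamma_fact natr1 in W2.
apply/andP; split.
  rewrite lef_pV2 ?posrE//; apply: le_trans W2 _; rewrite factS natrM.
  by rewrite ler_wpM2r// ler1_powR ?ler1n// gerBl.
rewrite ler_pdivlMr// mulrC ler_pdivrMr//; apply: le_trans W1 _.
rewrite ler_wpM2r ?(ltW G0)//.
have a10 : 0 <= k.+1%:R * al t + 1 by rewrite addr_ge0.
apply: le_trans (powR_le_lin a10 y01) _.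
rewrite -subr_ge0.
have -> : 1 + y * k.+1%:R - (1 - y + y * (k.+1%:R * al t + 1)) =
  y * (k.+1%:R * (1 - al t)) by ring.
by rewrite -/y mulr_ge0.
Unshelve. all: by end_near. Qed.

Lemma mittag_leffler_cvg_expR {U : Type} (F : set_system U) {FF : ProperFilter F}
    (al : U -> R) lambda T : 0 < lambda -> 0 < T ->
  (\forall t \near F, 0 < al t < 1) -> al t @[t --> F] --> (1 : R) ->
  mittag_leffler (al t) 1 (- lambda * T `^ al t) @[t --> F] -->
    expR (- (lambda * T)).
Proof.
move=> l0 T0 al01 al1.
rewrite (funext (fun t => mittag_leffler1E (al t) (- lambda * T `^ al t))).
rewrite /expR /exp_coeff.
pose X := lambda * (1 + T).
have X0 : 0 < X by rewrite mulr_gt0// addr_gt0.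
pose M := (Num.truncn X).+1.
have XM : X < M%:R by exact: real_truncnS_gt (num_real X).
have M0 : (0 : R) < M%:R by [].
have TT : T `^ al t @[t --> F] --> T.
  rewrite /powR gt_eqF// -[X in _ --> X](@lnK _ T) ?posrE//.
  apply: continuous_cvg; first exact: continuous_expR.
  by rewrite -[X in _ --> X]mul1r; apply: cvgMl.
(* The inverse of Gamma is bounded by its Gauss-Euler expression at n = M^2. For alpha >= 1/2 this
   yields (M^2)^(- k alpha) <= M^(- k), and with lambda T^alpha <= X < M a majorant free of
   alpha. *)
apply: (@tannery _ _ _ _ _ (fun k => (X / M%:R) ^+ k * negbin (k%:R + 1) (M * M)%N)).
- near=> t => k.
  have /andP[a0 a1] : 0 < al t < 1 by near: t.
  have ah : 2^-1 <= al t.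
    by apply: ltW; near: t; apply: (cvgr_gt _ al1); rewrite invf_lt1// ltr1n.
  have ka : 0 <= k%:R * al t by rewrite mulr_ge0// ltW.
  have kk : k%:R * al t <= k%:R by rewrite ler_piMr// ltW.
  have G0 := Gamma_gt0 ka.
  rewrite mulNr normrM normrX normrN normfV (gtr0_norm G0).
  rewrite ger0_norm ?mulr_ge0 ?powR_ge0 ?(ltW l0)//.
  rewrite expr_div_n -mulrA; apply: ler_pM.
  + by rewrite exprn_ge0// mulr_ge0 ?powR_ge0 ?(ltW l0).
  + by rewrite invr_ge0 ltW.
  + apply: lerXn2r; rewrite ?nnegrE ?mulr_ge0 ?powR_ge0 ?addr_ge0 ?(ltW l0) ?(ltW T0)//.
    rewrite ler_wpM2l ?(ltW l0)//.
    have a01' : 0 <= al t <= 1 by rewrite !ltW.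
    apply: le_trans (powR_le_lin (ltW T0) a01') _.
    apply: lerD; first by rewrite gerBl ltW.
    by rewrite ler_piMl ?ltW.
  + apply: le_trans (Gamma_inv_le ka (_ : 0 < M * M)%N) _ => //.
    rewrite mulrC; apply: ler_pM; rewrite ?powR_ge0 ?negbin_ge0 ?addr_ge0//; last first.
      by rewrite ler_negbin ?addr_ge0// lerD2r.
    rewrite powRN lef_pV2 ?posrE ?exprn_gt0 ?powR_gt0 ?ltr0n//.
    rewrite -powR_mulrn ?ler0n// natrM powRM ?ler0n// -powRD; last first.
      by apply/implyP => _; rewrite gt_eqF.
    have M1 : 1 <= M%:R :> R by rewrite ler1n.
    apply: (ler_powR M1).
    by rewrite -mulrDr ler_peMr//; lra.
- apply: cvg_negbin_pow; rewrite divr_ge0 ?(ltW X0) ?(ltW M0)//=.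
  by rewrite ltr_pdivrMr ?mul1r.
- move=> k; apply: cvgM; last exact: cvg_Gamma_alpha.
  have H : - lambda * T `^ al t @[t --> F] --> - (lambda * T).
    by rewrite -mulNr; apply: cvgMr.
  exact: (cvg_comp _ _ H (@exprn_continuous R k _)).
Unshelve. all: by end_near. Qed.

End mittag_leffler_bounds.

(** * Open sets are Lebesgue measurable *)

Section lebesgue_measurability.
Context {R : realType} {n : nat}.
Local Notation V := 'rV[R]_n.+1.

Definition lower_half (i : 'I_n.+1) (c : R) : set V := [set x | x ord0 i <= c].

Lemma interval_length_split (x y c : R) :
  Num.max 0 (Num.min y c - x) + Num.max 0 (y - Num.max x c) = Num.max 0 (y - x).
Proof.
have [yc|cy] := leP y c; have [xc|cx] := leP x c.
- by rewrite [X in _ + X]max_l ?addr0// subr_le0.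
- by rewrite max_l ?addr0// subr_le0; exact: le_trans yc (ltW cx).
- rewrite !max_r ?subr_ge0 ?(ltW cy)//; first by rewrite addrC subrKA.
  exact: le_trans xc (ltW cy).
- by rewrite [X in X + _]max_l ?add0r// subr_le0 ltW.
Qed.

Lemma box_volume_split (a b : V) (i : 'I_n.+1) (c : R) :
  box_volume (a, \row_j (if j == i then Num.min (b ord0 i) c else b ord0 j)) +
  box_volume (\row_j (if j == i then Num.max (a ord0 i) c else a ord0 j), b) =
  box_volume (a, b).
Proof.
have E (u v : V) : (forall j, j != i -> u ord0 j = a ord0 j) ->
    (forall j, j != i -> v ord0 j = b ord0 j) ->
    box_volume (u, v) = Num.max 0 (v ord0 i - u ord0 i) *
      \prod_(j < n.+1 | j != i) Num.max 0 (b ord0 j - a ord0 j).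
  move=> ua vb; rewrite /box_volume (bigD1 i)//=; congr (_ * _).
  by apply: eq_bigr => j ji; rewrite ua ?vb.
rewrite !E //; try by move=> j /negbTE ji; rewrite mxE ji.
rewrite -mulrDl !mxE eqxx; congr (_ * _).
exact: interval_length_split.
Qed.

(** Cutting every box of a cover along the hyperplane gives covers of both pieces with the same
    total volume. *)
Lemma lower_half_caratheodory i c :
  (@lebesgue_outer R n).-caratheodory (lower_half i c).
Proof.
apply: le_caratheodory_measurable => X.
apply: le_ereal_inf_tmp => _ [B XB <-].
pose B1 k : V * V := ((B k).1, \row_j (if j == i then Num.min ((B k).2 ord0 i) c else (B k).2 ord0 j)).
pose B2 k : V * V := (\row_j (if j == i then Num.max ((B k).1 ord0 i) c else (B k).1 ord0 j), (B k).2).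
have -> : (\sum_(k <oo) (box_volume (B k))%:E =
    \sum_(k <oo) ((box_volume (B1 k))%:E + (box_volume (B2 k))%:E))%E.
  apply: eq_eseriesr => k _; rewrite -EFinD; congr EFin.
  by rewrite /B1 /B2; case: (B k) => a b; rewrite box_volume_split.
rewrite nneseriesD; [|by move=> k _ _; rewrite lee_fin box_volume_ge0..].
apply: leeD; apply: ereal_inf_lbound.
- exists B1 => // x [Xx Hx]; have [k _ Bx] := XB _ Xx; exists k => // j /=.
  have /andP[h1 h2] := Bx j; rewrite h1 /= mxE; case: eqP => // ->.
  by rewrite le_min; have /andP[_ ->] := Bx i.
- exists B2 => // x [Xx Hx]; have [k _ Bx] := XB _ Xx; exists k => // j /=.
  have /andP[h1 h2] := Bx j; rewrite h2 andbT mxE; case: eqP => // ->.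
  have /andP[h _] := Bx i; rewrite ge_max h /= ltW// ltNge; exact/negP.
Qed.

(** Half-open cubes with rational centre and half-width are intersections of differences of
    half-spaces, and the countably many inside Omega fill it: for a sup-norm ball of radius e around
    x, a half-width r < e/2 and a centre within r of x keep the whole cube within 2 r < e of x. *)
Lemma open_lebesgue_measurable (Omega : set V) : open Omega ->
  measurable (Omega : set (lebesgueRV R n)).
Proof.
move=> oO.
pose H i c : set (lebesgueRV R n) := lower_half i c.
have mH i c : measurable (H i c) by exact: lower_half_caratheodory.
pose cube (q : 'rV[rat]_n.+1 * rat) : set (lebesgueRV R n) :=
  \bigcap_(i in [set: 'I_n.+1]) (H i (ratr (q.1 ord0 i + q.2)) `\` H i (ratr (q.1 ord0 i - q.2))).
have mcube q : measurable (cube q).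
  by apply: fin_bigcap_measurable => // i _; exact: measurableD.
pose F q := if pselect (cube q `<=` Omega) then cube q else set0.
have -> : Omega = \bigcup_q F q.
  apply/seteqP; split; last first.
    by move=> x [q _]; rewrite /F; case: pselect => // qO; exact: qO.
  move=> x Ox.
  have /nbhs_ballP[e /= e0 xe] : nbhs x Omega by exact: open_nbhs_nbhs.
  have [r] := @rat_in_itvoo R 0 (e / 2) (divr_gt0 e0 (ltr0n _ 2)).
  rewrite in_itv/= => /andP[r0 re].
  have qx i : {q : rat | ratr q \in `]x ord0 i - ratr r, x ord0 i + ratr r[%R}.
    by apply/cid/rat_in_itvoo; rewrite ltrD2l gtrN.
  pose q : 'rV[rat]_n.+1 := \row_i sval (qx i).
  have qP i : x ord0 i - ratr r < ratr (q ord0 i) < x ord0 i + ratr r.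
    by rewrite mxE; case: (qx i) => /= t; rewrite in_itv.
  exists (q, r) => //; rewrite /F; case: pselect => /= [?|]; last first.
    move=> nqO; exfalso; apply: nqO => y cy; apply: xe; split=> // k i; rewrite (ord1 k) /ball/=.
    have [/= h1 /negP] := cy i I; rewrite /H /lower_half/= -ltNge => h2.
    rewrite /H /lower_half /= rmorphD in h1; rewrite rmorphB in h2.
    have /andP[q1 q2] := qP i.
    have -> : e = e / 2 + e / 2 by exact: splitr.
    clear - q1 q2 h1 h2 re; rewrite ltr_norml; apply/andP; split; lra.
  move=> i _; have /andP[q1 q2] := qP i.
  split; rewrite /H /lower_half/= ?rmorphD ?rmorphB/=; first by lra.
  by apply/negP; rewrite -ltNge; lra.
apply: countable_bigcupT_measurable; first exact: countableP.
by move=> q; rewrite /F; case: pselect => /= _; [exact: mcube|exact: measurable0].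
Qed.

End lebesgue_measurability.

(** * Orthonormal expansions in L2 *)

Section square_integrable.
Context {d : measure_display} {T : measurableType d} {R : realType}.
Variables (mu : {measure set T -> \bar R}) (D : set T).
Hypothesis mD : measurable D.
Implicit Types (f g h : T -> R).

(** [L2] over an arbitrary measure space; for Lebesgue measure the two agree by definition. *)
Definition sqint f := measurable_fun D f /\
  (\int[mu]_(x in D) ((f x) ^+ 2)%:E < +oo)%E.

Definition ip f g : R := \int[mu]_(x in D) (f x * g x).

Lemma ipC f g : ip f g = ip g f.
Proof. by apply: eq_Rintegral => x _; rewrite mulrC. Qed.

Lemma sqint_integrable f : sqint f ->
  mu.-integrable D (EFin \o (fun x => f x ^+ 2)).
Proof.
move=> [mf fi]; apply/integrableP; split.
  by apply/measurable_EFinP; apply: measurable_funX.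
by under eq_integral do rewrite /= ger0_norm ?sqr_ge0//.
Qed.

Lemma sqint_dom f h : measurable_fun D f -> mu.-integrable D (EFin \o h) ->
  (forall x, D x -> f x ^+ 2 <= h x) -> sqint f.
Proof.
move=> mf hi fh; split => //.
have mE : measurable_fun D (EFin \o (fun x => f x ^+ 2)).
  by apply/measurable_EFinP; apply: measurable_funX.
have : mu.-integrable D (EFin \o (fun x => f x ^+ 2)).
  apply: (le_integrable mD mE _ hi) => x Dx /=.
  rewrite lee_fin ger0_norm ?sqr_ge0//; apply: le_trans (fh _ Dx) _; exact: ler_norm.
move=> /integrableP[_]; congr (_ < _)%E.
by apply: eq_integral => x _ /=; rewrite ger0_norm// sqr_ge0.
Qed.

Lemma sqint_mul f g : sqint f -> sqint g ->
  mu.-integrable D (EFin \o (fun x => f x * g x)).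
Proof.
move=> sf sg; have [mf _] := sf; have [mg _] := sg.
have H := integrableD mD (sqint_integrable sf) (sqint_integrable sg).
have mE : measurable_fun D (EFin \o (fun x => f x * g x)).
  by apply/measurable_EFinP; exact: measurable_funM.
apply: (le_integrable mD mE _ H) => x Dx /=; rewrite lee_fin.
rewrite normrM [leRHS]ger0_norm ?addr_ge0 ?sqr_ge0//.
rewrite -(real_normK (num_real (f x))) -(real_normK (num_real (g x))).
by have := sqr_ge0 (`|f x| - `|g x|); have := normr_ge0 (f x);
  have := normr_ge0 (g x); nra.
Qed.

Lemma sqint0 : sqint (fun=> 0).
Proof.
split; first exact: measurable_cst.
by under eq_integral do rewrite expr0n/=; rewrite integral0.
Qed.

Lemma sqintZ a f : sqint f -> sqint (fun x => a * f x).
Proof.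
move=> sf; have [mf _] := sf; apply: (@sqint_dom _ (fun x => a ^+ 2 * f x ^+ 2)).
- by apply: measurable_funM => //; exact: measurable_cst.
- by apply: eq_integrable (integrableZl mD (a ^+ 2) (sqint_integrable sf)).
- by move=> x _; rewrite exprMn.
Qed.

Lemma sqintD f g : sqint f -> sqint g -> sqint (fun x => f x + g x).
Proof.
move=> sf sg; have [mf _] := sf; have [mg _] := sg.
have sff := sqint_integrable sf; have sgg := sqint_integrable sg.
apply: (@sqint_dom _ (fun x => (f x ^+ 2 + g x ^+ 2) + (f x ^+ 2 + g x ^+ 2))).
- exact: measurable_funD.
- have H := integrableD mD sff sgg.
  by apply: eq_integrable (integrableD mD H H).
- move=> x _; have := sqr_ge0 (f x - g x); nra.
Qed.

Lemma sqintB f g : sqint f -> sqint g -> sqint (fun x => f x - g x).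
Proof.
move=> sf sg; have := sqintD sf (sqintZ (-1) sg).
by under [X in sqint X -> _]funext do rewrite mulN1r.
Qed.

Lemma sqint_sum (v : nat -> T -> R) m N : (forall k, sqint (v k)) ->
  sqint (fun x => \sum_(m <= k < N) v k x).
Proof.
move=> sv; elim: N => [|N IH].
  rewrite (_ : (fun x => _) = (fun=> 0)); first exact: sqint0.
  by apply/funext => x; rewrite big_geq.
have [mN|Nm] := leqP m N.
  rewrite (_ : (fun x => _) = (fun x => \sum_(m <= k < N) v k x + v N x)).
    exact: sqintD.
  by apply/funext => x; rewrite big_nat_recr.
rewrite (_ : (fun x => _) = (fun=> 0)); first exact: sqint0.
by apply/funext => x; rewrite big_geq.
Qed.

Lemma ipDl f g h : sqint f -> sqint g -> sqint h ->
  ip (fun x => f x + g x) h = ip f h + ip g h.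
Proof.
move=> sf sg sh; rewrite /ip -RintegralD//; try exact: sqint_mul.
by apply: eq_Rintegral => x _; rewrite mulrDl.
Qed.

Lemma ipZl a f g : sqint f -> sqint g -> ip (fun x => a * f x) g = a * ip f g.
Proof.
move=> sf sg; rewrite /ip -RintegralZl//; last exact: sqint_mul.
by apply: eq_Rintegral => x _; rewrite mulrA.
Qed.

Lemma ipBl f g h : sqint f -> sqint g -> sqint h ->
  ip (fun x => f x - g x) h = ip f h - ip g h.
Proof.
move=> sf sg sh; rewrite -mulN1r -ipZl// -ipDl//; last exact: sqintZ.
by apply: eq_Rintegral => x _; rewrite mulN1r.
Qed.

Lemma ip_suml (v : nat -> T -> R) m N g : (forall k, sqint (v k)) -> sqint g ->
  ip (fun x => \sum_(m <= k < N) v k x) g = \sum_(m <= k < N) ip (v k) g.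
Proof.
move=> sv sg; have ip0 : ip (fun=> 0) g = 0.
  have := ipZl 0 sg sg; rewrite mul0r => E; rewrite -[RHS]E.
  by apply: eq_Rintegral => x _; rewrite !mul0r.
have Z (N' : nat) : (N' <= m)%N -> (fun x => \sum_(m <= k < N') v k x) = (fun=> 0).
  by move=> Nm; apply/funext => x; rewrite big_geq.
elim: N => [|N IH]; first by rewrite Z// big_geq.
have [mN|Nm] := leqP m N; last by rewrite Z// big_geq.
rewrite big_nat_recr//= -IH -ipDl//; last exact: sqint_sum.
by apply: eq_Rintegral => x _; rewrite big_nat_recr.
Qed.

Lemma ip_ge0 f : 0 <= ip f f.
Proof. by apply: Rintegral_ge0 => x _; rewrite -expr2 sqr_ge0. Qed.

Lemma ip_sqrD a f g : sqint f -> sqint g ->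
  ip (fun x => f x + a * g x) (fun x => f x + a * g x) =
  ip f f + 2 * a * ip f g + a ^+ 2 * ip g g.
Proof.
move=> sf sg; have sag := sqintZ a sg; have sfg := sqintD sf sag.
rewrite ipDl// ipZl// ![ip _ (fun x => f x + _)]ipC !ipDl// !ipZl// [ip g f]ipC.
by ring.
Qed.

Lemma ip_sqr_add_le f g : sqint f -> sqint g ->
  ip (fun x => f x + g x) (fun x => f x + g x) <= 2 * ip f f + 2 * ip g g.
Proof.
move=> sf sg.
have E : ip (fun x => f x + g x) (fun x => f x + g x) =
    ip f f + 2 * ip f g + ip g g.
  rewrite -[ip g g]mul1r -[X in X * ip g g](expr1n _ 2) -[2 * ip f g]mulr1 mulrAC -ip_sqrD//.
  by apply: eq_Rintegral => x _; rewrite mul1r.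
have := ip_ge0 (fun x => f x + (-1) * g x); rewrite ip_sqrD// E; lra.
Qed.

Lemma ip_CS f g : sqint f -> sqint g -> ip f g ^+ 2 <= ip f f * ip g g.
Proof.
move=> sf sg; have [g0|gn0] := eqVneq (ip g g) 0.
  have [fg0|fgn0] := eqVneq (ip f g) 0; first by rewrite fg0 g0 expr0n mulr0.
  (* When [ip g g = 0] the quadratic polynomial is affine in the coefficient of g, and this
     coefficient makes it equal to -1. *)
  have := ip_ge0 (fun x => f x + (- (ip f f + 1) / (2 * ip f g)) * g x).
  rewrite ip_sqrD// g0 mulr0 addr0.
  have -> : 2 * (- (ip f f + 1) / (2 * ip f g)) * ip f g = - (ip f f + 1) by field.
  by rewrite opprD addrA subrr add0r ler0N1.
have g0 : 0 < ip g g by rewrite lt_neqAle eq_sym gn0 ip_ge0.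
have := ip_ge0 (fun x => f x + (- ip f g / ip g g) * g x).
rewrite ip_sqrD//.
have -> : ip f f + 2 * (- ip f g / ip g g) * ip f g + (- ip f g / ip g g) ^+ 2 * ip g g =
  (ip f f * ip g g - ip f g ^+ 2) / ip g g by field.
by rewrite pmulr_lge0 ?invr_gt0// subr_ge0.
Qed.

End square_integrable.

(** * Riesz-Fischer, Bessel and Parseval *)

Section orthonormal_series.
Context {d : measure_display} {T : measurableType d} {R : realType}.
Variables (mu : {measure set T -> \bar R}) (D : set T).
Hypothesis mD : measurable D.
Variable phi : nat -> T -> R.
Hypothesis sphi : forall k, sqint mu D (phi k).
Hypothesis ophi : forall j k, ip mu D (phi j) (phi k) = (j == k)%:R.
Implicit Types (f g h : T -> R) (c : nat -> R).

Definition osum c m N (x : T) : R := \sum_(m <= k < N) c k * phi k x.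

Lemma sqint_osum c m N : sqint mu D (osum c m N).
Proof. by apply: sqint_sum => // k; exact: sqintZ. Qed.

Lemma ip_osuml c m N g : sqint mu D g ->
  ip mu D (osum c m N) g = \sum_(m <= k < N) c k * ip mu D (phi k) g.
Proof.
move=> sg; rewrite /osum (ip_suml mD (v := fun k x => c k * phi k x))//.
  by apply: eq_bigr => k _; rewrite ipZl.
by move=> k; exact: sqintZ.
Qed.

Lemma ip_osum_phi c m N j : (m <= j < N)%N ->
  ip mu D (osum c m N) (phi j) = c j.
Proof.
move=> mjN; rewrite ip_osuml// (bigD1_seq j) ?iota_uniq ?mem_index_iota//=.
rewrite ophi eqxx mulr1 big1 ?addr0// => k kj.
by rewrite ophi (negbTE kj) mulr0.
Qed.

Lemma ip_osum c m N :
  ip mu D (osum c m N) (osum c m N) = \sum_(m <= k < N) c k ^+ 2.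
Proof.
rewrite ip_osuml; last exact: sqint_osum.
rewrite !big_nat; apply: eq_bigr => k kmN.
by rewrite ipC ip_osum_phi.
Qed.

Lemma osumB c (m M N : nat) x : (m <= M)%N -> (M <= N)%N ->
  osum c m N x - osum c m M x = osum c M N x.
Proof.
by move=> mM MN; rewrite /osum (big_cat_nat mM MN)/= addrAC subrr add0r.
Qed.

Lemma ip_EFin f : sqint mu D f ->
  (\int[mu]_(x in D) ((f x) ^+ 2)%:E = (ip mu D f f)%:E)%E.
Proof.
move=> sf; rewrite /ip /Rintegral fineK.
  by apply: eq_integral => x _; rewrite expr2.
by apply: integrable_fin_num => //; exact: sqint_mul.
Qed.

(** Each term is at most the sum C, so (2^j |a_j|)^2 <= C; 1 + C serves as a bound for the square
    root of C. *)
Lemma pointwise_cvg_increments (a : nat -> R) :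
  (\sum_(j <oo) (4 ^+ j * a j ^+ 2)%:E < +oo)%E -> cvgn (series a).
Proof.
set S := (X in (X < _)%E) => Soo.
have t0 j : (0 <= (4 ^+ j * a j ^+ 2)%:E)%E.
  by rewrite lee_fin mulr_ge0 ?sqr_ge0 ?exprn_ge0.
have S0 : (0 <= S)%E by apply: nneseries_ge0.
have Sfin : S \is a fin_num by rewrite ge0_fin_numE.
pose C := fine S; have C0 : 0 <= C by rewrite fine_ge0.
apply: (@cvg_series_dominated _ _ (geometric (1 + C) 2^-1)); last first.
  by apply: is_cvg_geometric_series; rewrite ger0_norm ?invr_ge0// invf_lt1// ltr1n.
move=> j; rewrite /geometric/= exprVn ler_pdivlMr ?exprn_gt0//.
have H : 4 ^+ j * a j ^+ 2 <= C.
  rewrite -lee_fin fineK//; apply: le_trans (nneseries_lim_ge j.+1 _) => //.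
  by rewrite big_nat_recr//= leeDr// sume_ge0.
have {}H : (`|a j| * 2 ^+ j) ^+ 2 <= C.
  apply: le_trans H; rewrite exprMn real_normK ?num_real// mulrC -exprM mulnC exprM.
  by have -> : 2 ^+ 2 = 4 :> R by ring.
rewrite -(@ler_pXn2r _ 2) ?nnegrE ?mulr_ge0 ?exprn_ge0 ?addr_ge0//.
by apply: le_trans H _; rewrite sqrrD expr1n mul1r; nra.
Qed.

Lemma limn_einf_le (v : nat -> \bar R) (t : \bar R) :
  (forall j, (v j <= t)%E) -> (limn_einf v <= t)%E.
Proof.
move=> vt; rewrite limn_einf_lim; apply: lime_le; first exact: is_cvg_einfs.
apply: nearW => j; apply: le_trans (vt j).
by apply: ereal_inf_lbound; exists j => //=.
Qed.

(** The rate 8^(-j) is chosen to survive the weight 4^j: the products 2^(-j) are still summable. *)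
Lemma fast_subsequence (tail : nat -> R) : (forall m n, (m <= n)%N -> tail n <= tail m) ->
  tail @ \oo --> (0 : R) ->
  exists s : nat -> nat, (forall j, (j <= s j)%N) /\ (forall j, (s j <= s j.+1)%N) /\
    forall j, tail (s j) <= 8 ^- j.
Proof.
move=> tn t0.
have [N0 HN0] : {N : nat -> nat & forall j, tail (N j) <= 8 ^- j}.
  apply: (@choice _ _ (fun j N => tail N <= 8 ^- j)) => j.
  have e0 : (0 : R) < 8 ^- j by rewrite invr_gt0 exprn_gt0.
  have /cvgrPdist_le /(_ _ e0) [N _ HN] := t0.
  exists N; have := HN N (leqnn N); rewrite sub0r normrN; apply: le_trans.
  exact: ler_norm.
pose s := fix s j := if j is i.+1 then maxn (s i).+1 (N0 i.+1) else N0 0%N.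
exists s; split; [|split] => [|j|j].
- by elim=> // j IH; rewrite /= leq_max ltnS IH.
- by rewrite /= leq_max leqnSn.
- apply: le_trans (HN0 j); apply: tn; case: j => //= j.
  by rewrite leq_maxr.
Qed.

Lemma riesz_fischer c (B : R) : (forall N, \sum_(0 <= k < N) c k ^+ 2 <= B) ->
  exists u, sqint mu D u /\
    ip mu D (fun x => osum c 0 N x - u x) (fun x => osum c 0 N x - u x)
      @[N --> \oo] --> (0 : R).
Proof.
move=> cB.
pose s := series (fun k => c k ^+ 2).
have s_nd : {homo s : n m / (n <= m)%N >-> n <= m}.
  apply/nondecreasing_seqP => m; rewrite -subr_ge0 sub_series leqnSn.
  by rewrite sumr_ge0// => k _; rewrite sqr_ge0.
have s_cvg : cvgn s.
  by apply: nondecreasing_is_cvgn => //; exists B => _ [N _ <-]; exact: cB.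
pose tail m := limn s - s m.
have tail0 : tail @ \oo --> (0 : R).
  by rewrite -[X in _ --> X](subrr (limn s)); apply: cvgB => //; exact: cvg_cst.
have tail_ge m N : (m <= N)%N -> \sum_(m <= k < N) c k ^+ 2 <= tail m.
  move=> mN; have := sub_series (fun k => c k ^+ 2) m N; rewrite mN => <-.
  by rewrite lerB//; exact: nondecreasing_cvgn_le.
have [nj [jn [nn tn]]] : exists s : nat -> nat, (forall j, (j <= s j)%N) /\
    (forall j, (s j <= s j.+1)%N) /\ forall j, tail (s j) <= 8 ^- j.
  by apply: fast_subsequence => // m n mn; rewrite lerB// s_nd.
pose Delta j := osum c (nj j) (nj j.+1).
(* The weights 4^j make almost every sequence of increments geometrically small, while the integral
   of [hh j] is at most 4^j 8^(-j) = 2^(-j). *)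
pose hh j x : \bar R := (4 ^+ j * Delta j x ^+ 2)%:E.
have mosum m N : measurable_fun D (osum c m N) by case: (sqint_osum c m N).
have mDelta2 j : measurable_fun D (EFin \o (fun x => Delta j x ^+ 2)).
  by apply/measurable_EFinP; apply: measurable_funX; exact: mosum.
have mhh j : measurable_fun D (hh j).
  have : measurable_fun D (EFin \o (fun x => 4 ^+ j * Delta j x ^+ 2)).
    apply/measurable_EFinP; apply: measurable_funM; first exact: measurable_cst.
    by apply: measurable_funX; exact: mosum.
  by [].
have hh0 j x : (0 <= hh j x)%E by rewrite lee_fin mulr_ge0 ?sqr_ge0 ?exprn_ge0.
have Ihh j : (\int[mu]_(x in D) hh j x <= (geometric 1 2^-1 j)%:E)%E.
  have -> : (\int[mu]_(x in D) hh j x =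
      (4 ^+ j)%:E * \int[mu]_(x in D) (Delta j x ^+ 2)%:E)%E.
    have h0 x : D x -> (0 <= ((Delta j x ^+ 2)%R)%:E)%E.
      by rewrite lee_fin sqr_ge0.
    have := ge0_integralZl_EFin mu mD h0 (mDelta2 j) (exprn_ge0 j (ler0n R 4)).
    by move=> <-; apply: eq_integral => x _; rewrite -EFinM.
  rewrite ip_EFin; last exact: sqint_osum.
  rewrite ip_osum -EFinM lee_fin /geometric/= mul1r.
  apply: (@le_trans _ _ (4 ^+ j * 8 ^- j)).
    rewrite ler_wpM2l ?exprn_ge0//; apply: le_trans (tail_ge _ _ (nn j)) (tn j).
  rewrite -exprVn -exprMn le_eqVlt; apply/orP; left; apply/eqP; congr (_ ^+ j).
  by field.
have IH : (\int[mu]_(x in D) (\sum_(j <oo) hh j x) < +oo)%E.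
  rewrite integral_nneseries//.
  apply: (@le_lt_trans _ _ (\sum_(j <oo) (geometric 1 2^-1 j)%:E)%E).
    by apply: lee_nneseries => // j _ _; rewrite integral_ge0.
  have gc : cvgn (series (geometric (1 : R) 2^-1)).
    by apply: is_cvg_geometric_series; rewrite ger0_norm ?invr_ge0// invf_lt1// ltr1n.
  apply: (@le_lt_trans _ _ (limn (series (geometric (1 : R) 2^-1)))%:E); last exact: ltry.
  apply: lime_le.
    by apply: is_cvg_nneseries => j _ _; rewrite lee_fin /geometric/= mul1r exprn_ge0.
  apply: nearW => N; rewrite sumEFin lee_fin.
  apply: (nondecreasing_cvgn_le _ gc).
  apply/nondecreasing_seqP => m; rewrite -subr_ge0 sub_series leqnSn.
  by rewrite sumr_ge0// => k _; rewrite /geometric/= mul1r exprn_ge0.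
have Hae : {ae mu, forall x, D x -> cvgn (fun j => osum c 0 (nj j) x)}.
  have mH : measurable_fun D (fun x => \sum_(j <oo) hh j x)%E.
    by apply: (@ge0_emeasurable_sum _ _ _ D hh xpredT) => // j x _ _; exact: hh0.
  have iH : mu.-integrable D (fun x => \sum_(j <oo) hh j x)%E.
    apply/integrableP; split => //.
    by under eq_integral => x _ do rewrite gee0_abs ?nneseries_ge0//.
  apply: filterS (integrable_ae mD iH) => x H Dx; have {}H := H Dx.
  have {}H : (\sum_(j <oo) hh j x < +oo)%E.
    by rewrite -ge0_fin_numE// nneseries_ge0.
  have /pointwise_cvg_increments H' : (\sum_(j <oo) (4 ^+ j * Delta j x ^+ 2)%:E < +oo)%E by [].
  have E j : osum c 0 (nj j) x = osum c 0 (nj 0%N) x + series (Delta ^~ x) j.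
    elim: j => [|j IHj]; first by rewrite /series/= big_geq// addr0.
    rewrite /series/= big_nat_recr//= addrA -[X in X + _]IHj /Delta.
    rewrite -(osumB _ _ (leq0n _) (nn j)).
    by rewrite addrCA subrr addr0.
  by rewrite (funext E); apply: is_cvgD => //; exact: is_cvg_cst.
(* An upper limit is measurable without removing the null set on which the subsequence may diverge;
   its values there do not matter. *)
pose u x := fine (limn_esup (fun j => (osum c 0 (nj j) x)%:E)).
have mu_ : measurable_fun D u.
  apply: (measurableT_comp (f := fine)); first exact: fine_measurable.
  apply: measurable_fun_limn_esup => j; apply/measurable_EFinP; exact: mosum.
have uae : {ae mu, forall x, D x -> osum c 0 (nj j) x @[j --> \oo] --> u x}.
  apply: filterS Hae => x H Dx; have {}H := H Dx.
  have /cvg_limn_einf_sup[_ E] : (osum c 0 (nj j) x)%:E @[j --> \oo] -->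
      (limn (fun j => osum c 0 (nj j) x))%:E.
    by apply: cvg_EFin; [exact: nearW|exact: H].
  by rewrite /u E /=; exact: H.
(* Fatou's lemma along the subsequence. The shift by M makes its index at least M, so the difference
   is, up to sign, a block starting at M, with squared norm at most [tail M]. *)
have key M : (\int[mu]_(x in D) ((osum c 0 M x - u x) ^+ 2)%:E <= (tail M)%:E)%E.
  pose v j x : \bar R := ((osum c 0 M x - osum c 0 (nj (j + M)%N) x) ^+ 2)%:E.
  have mv j : measurable_fun D (v j).
    have : measurable_fun D (EFin \o (fun x => (osum c 0 M x - osum c 0 (nj (j + M)%N) x) ^+ 2)).
      by apply/measurable_EFinP; apply: measurable_funX; exact: measurable_funB.
    by [].
  have mw : measurable_fun D (EFin \o (fun x => (osum c 0 M x - u x) ^+ 2)).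
    by apply/measurable_EFinP; apply: measurable_funX; exact: measurable_funB.
  have -> : (\int[mu]_(x in D) ((osum c 0 M x - u x) ^+ 2)%:E =
      \int[mu]_(x in D) limn_einf (v ^~ x))%E.
    apply: ae_eq_integral => //.
      apply: (eq_measurable_fun (fun x => - limn_esup (fun j => - v j x))%E) => //.
      apply: measurableT_comp => //; apply: measurable_fun_limn_esup => j.
      exact: measurableT_comp.
    apply: filterS uae => x H Dx; have {}H := H Dx.
    have /cvg_limn_einf_sup[-> _] : v j x @[j --> \oo] --> ((osum c 0 M x - u x) ^+ 2)%:E.
      apply: cvg_EFin; first exact: nearW.
      have H1 : osum c 0 M x - osum c 0 (nj (j + M)%N) x @[j --> \oo] --> osum c 0 M x - u x.
        apply: cvgB; first exact: cvg_cst.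
        by rewrite (cvg_shiftn M (fun j => osum c 0 (nj j) x)).
      exact: (cvg_comp _ _ H1 (@exprn_continuous R 2 _)).
    by [].
  apply: (le_trans (fatou _ _ _ _)) => //; first by move=> j x _; rewrite lee_fin sqr_ge0.
  apply: limn_einf_le => j.
  have MN : (M <= nj (j + M))%N by apply: leq_trans (jn _); exact: leq_addl.
  have -> : (\int[mu]_(x in D) v j x = \int[mu]_(x in D) ((osum c M (nj (j + M)%N) x) ^+ 2)%:E)%E.
    by apply: eq_integral => x _; rewrite /v -(osumB _ _ (leq0n _) MN) -sqrrN opprB.
  rewrite ip_EFin; last exact: sqint_osum.
  by rewrite ip_osum lee_fin tail_ge.
have su : sqint mu D u.
  split => //; apply: (@le_lt_trans _ _ (tail 0%N)%:E); last exact: ltry.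
  apply: le_trans (key 0%N).
  rewrite le_eqVlt; apply/orP; left; apply/eqP; apply: eq_integral => x _.
  by rewrite /osum big_geq// sub0r sqrrN.
exists u; split => //; apply: (squeeze_cvgr _ (cvg_cst 0) tail0).
near=> N; rewrite ip_ge0/= -lee_fin -ip_EFin; first exact: key.
by apply: sqintB => //; exact: sqint_osum.
Unshelve. all: by end_near. Qed.

Lemma cvg_ip0 (w : nat -> T -> R) g : (forall N, sqint mu D (w N)) -> sqint mu D g ->
  ip mu D (w N) (w N) @[N --> \oo] --> (0 : R) ->
  ip mu D (w N) g @[N --> \oo] --> (0 : R).
Proof.
move=> sw sg w0.
have H : ip mu D (w N) g ^+ 2 @[N --> \oo] --> (0 : R).
  have L : ip mu D (w N) (w N) * ip mu D g g @[N --> \oo] --> (0 : R).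
    by rewrite -[X in _ --> X](mul0r (ip mu D g g)); apply: cvgMl.
  apply: (squeeze_cvgr _ (cvg_cst 0) L).
  by near=> N; rewrite sqr_ge0 ip_CS.
apply: norm_cvg0.
rewrite -[X in _ --> X](@sqrtr0 R) (_ : (fun N => _) = (fun N => Num.sqrt (ip mu D (w N) g ^+ 2))).
  by apply: continuous_cvg => //; exact: sqrt_continuous.
by apply/funext => N; rewrite sqrtr_sqr.
Unshelve. all: by end_near. Qed.

Lemma osum_limit_coef c u : sqint mu D u ->
  ip mu D (fun x => osum c 0 N x - u x) (fun x => osum c 0 N x - u x)
    @[N --> \oo] --> (0 : R) ->
  forall k, ip mu D u (phi k) = c k.
Proof.
move=> su cu k.
have sB N : sqint mu D (fun x => osum c 0 N x - u x).
  by apply: sqintB => //; exact: sqint_osum.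
have H := cvg_ip0 sB (sphi k) cu.
have H' : c k - ip mu D u (phi k) @[N --> \oo] --> (0 : R).
  apply: cvg_trans H; apply: near_eq_cvg; near=> N.
  rewrite ipBl//; last exact: sqint_osum.
  by rewrite ip_osum_phi//=; near: N; exact: nbhs_infty_gt.
have E : c k - ip mu D u (phi k) = 0.
  by apply/esym; apply: cvg_unique H' _ => //; exact: cvg_cst.
by apply/esym/eqP; rewrite -subr_eq0 E.
Unshelve. all: by end_near. Qed.

Lemma ip_pythagoras f N : sqint mu D f ->
  let S := osum (fun k => ip mu D f (phi k)) 0 N in
  ip mu D (fun x => f x - S x) (fun x => f x - S x) =
  ip mu D f f - \sum_(0 <= k < N) ip mu D f (phi k) ^+ 2.
Proof.
move=> sf S; have sS : sqint mu D S by exact: sqint_osum.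
have sfS := sqintB mD sf sS.
rewrite ipBl// ![ip _ _ _ (fun x => f x - S x)]ipC !ipBl//.
rewrite ip_osum [ip _ _ f S]ipC ip_osuml//.
have -> : \sum_(0 <= k < N) ip mu D f (phi k) * ip mu D (phi k) f =
    \sum_(0 <= k < N) ip mu D f (phi k) ^+ 2.
  by apply: eq_bigr => k _; rewrite [ip _ _ (phi k) f]ipC.
by rewrite subrr subr0.
Qed.

Lemma bessel f N : sqint mu D f ->
  \sum_(0 <= k < N) ip mu D f (phi k) ^+ 2 <= ip mu D f f.
Proof.
by move=> sf; rewrite -subr_ge0 -ip_pythagoras// ip_ge0.
Qed.

Lemma ip_ae0 f : sqint mu D f -> {ae mu, forall x, D x -> f x = 0} ->
  ip mu D f f = 0.
Proof.
move=> sf f0; rewrite /ip /Rintegral (ae_eq_integral (cst 0%E))//.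
- by rewrite integral0.
- by have /integrableP[] := sqint_mul mD sf sf.
- by apply: filterS f0 => x H Dx; rewrite H// mul0r.
Qed.

(** By completeness f agrees almost everywhere with the Riesz-Fischer sum u of its own coefficients.
    Hence the partial sums converge to f and the Pythagorean identity passes to the limit. *)
Lemma parseval_le f (B : R) :
  (forall f, sqint mu D f -> (forall k, ip mu D f (phi k) = 0) ->
     {ae mu, forall x, D x -> f x = 0}) ->
  sqint mu D f -> (forall N, \sum_(0 <= k < N) ip mu D f (phi k) ^+ 2 <= B) ->
  ip mu D f f <= B.
Proof.
move=> complete sf fB; pose c k := ip mu D f (phi k).
have [u [su cu]] := riesz_fischer fB.
have uc := osum_limit_coef su cu.
have sw := sqintB mD su sf.
have w0 : ip mu D (fun x => u x - f x) (fun x => u x - f x) = 0.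
  by apply: ip_ae0 => //; apply: complete => // k; rewrite ipBl// uc subrr.
have L : 2 * ip mu D (fun x => osum c 0 N x - u x) (fun x => osum c 0 N x - u x) + B
    @[N --> \oo] --> B.
  rewrite -[X in _ --> X]add0r; apply: cvgD; last exact: cvg_cst.
  by rewrite -[X in _ --> X](mulr0 2); apply: cvgMr.
apply: (cvgr_to_ge L); near=> N.
apply: (@le_trans _ _ (ip mu D (fun x => f x - osum c 0 N x) (fun x => f x - osum c 0 N x) + B)).
  by rewrite ip_pythagoras// -addrA lerDl addrC subr_ge0; exact: fB.
rewrite lerD2r.
have sB : sqint mu D (fun x => osum c 0 N x - u x).
  by apply: sqintB => //; exact: sqint_osum.
have := ip_sqr_add_le mD sB sw; rewrite w0 mulr0 addr0; apply: le_trans.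
by rewrite le_eqVlt; apply/orP; left; apply/eqP; apply: eq_Rintegral => x _; ring.
Unshelve. all: by end_near. Qed.


End orthonormal_series.

(** * Spectral operators and multipliers *)

Section spectral_calculus.
Context {R : realType} {n : nat}.
Variables (Omega : set 'rV[R]_n.+1) (lam : nat -> R) (phi : nat -> 'rV[R]_n.+1 -> R).
Hypothesis mO : measurable (Omega : set (lebesgueRV R n)).
Local Notation leb := (@lebesgueRV_measure R n).
Local Notation sq := (@sqint _ _ _ leb Omega).
Local Notation "<[ f , g ]>" := (@ip _ _ _ leb Omega f g).
Hypothesis sphi : forall k, sq (phi k).
Hypothesis ophi : forall j k, <[phi j, phi k]> = (j == k)%:R.

Lemma L2norm_sqr f : L2norm Omega f ^+ 2 = <[f, f]>.
Proof. by rewrite sqr_sqrtr// ip_ge0. Qed.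

Lemma L2norm_cvg0 {U : Type} (F : set_system U) {FF : Filter F}
    (w : U -> 'rV[R]_n.+1 -> R) :
  L2norm Omega (w t) @[t --> F] --> (0 : R) <->
  <[w t, w t]> @[t --> F] --> (0 : R).
Proof.
split=> H.
  rewrite (_ : (fun t => _) = (fun t => L2norm Omega (w t) * L2norm Omega (w t))).
    by rewrite -[X in _ --> X](mulr0 0); exact: cvgM.
  by apply/funext => t; rewrite -expr2 L2norm_sqr.
rewrite -[X in _ --> X](@sqrtr0 R).
by apply: (cvg_comp _ _ H); exact: sqrt_continuous.
Qed.

(** Riesz-Fischer supplies a sum of the series, which excludes the junk value of [spectral_op];
    afterwards only coefficients are manipulated. *)
Lemma spectral_opP m f (B : R) : sq f ->
  (forall N, \sum_(0 <= k < N) (m k * <[f, phi k]>) ^+ 2 <= B) ->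
  sq (spectral_op Omega phi m f) /\
  forall k, <[spectral_op Omega phi m f, phi k]> = m k * <[f, phi k]>.
Proof.
move=> sf fB; pose c k := m k * <[f, phi k]>.
have [u [su cu]] := riesz_fischer mO sphi ophi fB.
have [sw cw] : L2_sum Omega (fun k x => m k * L2inner Omega f (phi k) * phi k x)
    (spectral_op Omega phi m f).
  apply: xgetPex; exists u; split; first exact: su.
  by apply/L2norm_cvg0; exact: cu.
split; first exact: sw.
apply: (osum_limit_coef mO sphi ophi (c := c)); first exact: sw.
by move: cw => /L2norm_cvg0; apply.
Qed.

Lemma spectral_op_boundedP m f (M : R) : sq f -> (forall k, `|m k| <= M) ->
  sq (spectral_op Omega phi m f) /\
  forall k, <[spectral_op Omega phi m f, phi k]> = m k * <[f, phi k]>.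
Proof.
move=> sf mM; apply: (@spectral_opP _ _ (M ^+ 2 * <[f, f]>)) => // N.
apply: (@le_trans _ _ (M ^+ 2 * \sum_(0 <= k < N) <[f, phi k]> ^+ 2)).
  rewrite mulr_sumr; apply: ler_sum => k _; rewrite exprMn ler_wpM2r ?sqr_ge0//.
  rewrite -real_normK ?num_real// lerXn2r ?nnegrE//.
  exact: le_trans (mM k).
by rewrite ler_wpM2l ?sqr_ge0// (bessel mO sphi ophi).
Qed.

Lemma landweber_coef mu s f i : 0 < mu ->
  (forall k, 0 <= mu * lam k `^ (- (2 * s)) <= 1) -> sq f ->
  sq (landweber Omega lam phi mu s f i) /\
  forall k, <[landweber Omega lam phi mu s f i, phi k]> =
    (1 - (1 - mu * lam k `^ (- (2 * s))) ^+ i) * <[f, phi k]>.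
Proof.
move=> mu0 rho sf; elim: i => [|i [sw cw]].
  split; first exact: sqint0.
  by move=> k; rewrite expr0 subrr mul0r /ip /Rintegral /=;
    under eq_integral do rewrite mul0r; rewrite integral0.
set w := landweber _ _ _ _ _ _ i in sw cw.
have swf : sq (w \- f) by exact: sqintB.
have mb k : `|lam k `^ (- (2 * s))| <= mu^-1.
  have /andP[_ r1] := rho k; rewrite ger0_norm ?powR_ge0//.
  by rewrite -[leRHS]mulr1 ler_pdivlMl.
have [sF cF] := spectral_op_boundedP swf mb.
have smF := sqintZ mO mu sF.
split; first exact: (sqintB mO sw smF).
move=> k /=.
have := ipBl mO sw smF (sphi k); rewrite (ipZl mO _ sF (sphi k)) cF => E.
apply: (etrans E); rewrite (ipBl mO sw sf (sphi k)) cw exprS; ring.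
Qed.

End spectral_calculus.

(** * Uniform bounds on the filtered and inverted multipliers *)

Section regularised_multipliers.
Context {R : realType}.
Implicit Types (rho lambda T alpha : R).

Lemma landweber_filter_itv rho i : 0 <= rho <= 1 ->
  0 <= 1 - (1 - rho) ^+ i <= 1.
Proof.
move=> /andP[r0 r1]; have h0 : 0 <= 1 - rho by rewrite subr_ge0.
by rewrite gerBl exprn_ge0// subr_ge0 exprn_ile1// gerBl.
Qed.

(** Bernoulli's inequality. *)
Lemma landweber_filter_le rho i : 0 <= rho <= 1 ->
  1 - (1 - rho) ^+ i <= i%:R * rho.
Proof.
move=> /andP[r0 r1]; have h0 : 0 <= 1 - rho by rewrite subr_ge0.
elim: i => [|i IH]; first by rewrite expr0 subrr mul0r.
rewrite exprS -natr1; have h1 : 0 <= (1 - rho) ^+ i by rewrite exprn_ge0.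
have h2 : (1 - rho) ^+ i <= 1 by rewrite exprn_ile1// gerBl.
nra.
Qed.

Lemma powR_le1D T alpha : 0 < alpha < 1 -> 0 < T -> T `^ alpha <= 1 + T.
Proof.
move=> /andP[a0 a1] T0.
have a01 : 0 <= alpha <= 1 by rewrite !ltW.
apply: le_trans (powR_le_lin (ltW T0) a01) _.
apply: lerD; first by rewrite gerBl ltW.
by rewrite ler_piMl ?ltW.
Qed.

Lemma mittag_leffler_arg_lt0 alpha lambda T : 0 < lambda -> 0 < T ->
  0 < lambda * T `^ alpha.
Proof. by move=> l0 T0; rewrite mulr_gt0// powR_gt0. Qed.

Lemma mittag_leffler_inv_le alpha lambda T : 0 < alpha < 1 -> 0 < lambda -> 0 < T ->
  0 < (mittag_leffler alpha 1 (- lambda * T `^ alpha))^-1 <=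
    1 + lambda * ((1 + T) / (1 - alpha)).
Proof.
move=> a01 l0 T0; have /andP[a0 a1] := a01.
have x0 := mittag_leffler_arg_lt0 alpha l0 T0.
have b0 : 0 < 1 - alpha by rewrite subr_gt0.
rewrite mulNr invr_gt0 mittag_leffler_gt0//=.
have := mittag_leffler_ge_rational a01 x0.
set E := mittag_leffler _ _ _; set x := lambda * _ in x0 * => H.
have E0 : 0 < E by rewrite mittag_leffler_gt0.
have q0 : 0 < (1 - alpha) / (x + (1 - alpha)) by rewrite divr_gt0// addr_gt0.
apply: (@le_trans _ _ ((1 - alpha) / (x + (1 - alpha)))^-1); first by rewrite lef_pV2.
rewrite invf_div mulrDl divff ?gt_eqF// addrC lerD2l mulrA ler_wpM2r ?invr_ge0 ?(ltW b0)//.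
by rewrite ler_wpM2l ?(ltW l0)// powR_le1D.
Qed.

(* Two regimes: for lambda (1 - alpha) <= 1 the exponential lower bound on the
   Mittag-Leffler function is sharp enough, otherwise 1 / (1 - alpha) < lambda
   and the rational one loses only a power of lambda. *)
Lemma mittag_leffler_ratio_le alpha lambda T : 0 < alpha < 1 -> 0 < lambda -> 0 < T ->
  expR (- (lambda * T)) / mittag_leffler alpha 1 (- lambda * T `^ alpha) <=
    expR 2 + 1 + (1 + T) * (4 / T ^+ 2).
Proof.
move=> a01 l0 T0; have /andP[a0 a1] := a01.
have b0 : 0 < 1 - alpha by rewrite subr_gt0.
have T1 : 0 <= (1 + T) * (4 / T ^+ 2).
  by rewrite mulr_ge0 ?addr_ge0 ?divr_ge0 ?exprn_ge0// ltW.
have [le1|gt1] := leP (lambda * (1 - alpha)) 1.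
  have E0 : 0 < mittag_leffler alpha 1 (- lambda * T `^ alpha).
    by rewrite mulNr mittag_leffler_gt0// mittag_leffler_arg_lt0.
  rewrite ler_pdivrMr//.
  apply: (@le_trans _ _ (expR 2 * mittag_leffler alpha 1 (- lambda * T `^ alpha))); last first.
    by rewrite ler_wpM2r ?(ltW E0)// -addrA lerDl addr_ge0.
  apply: le_trans (ler_wpM2l (expR_ge0 2) (mittag_leffler_ge a01 l0 T0)).
  by rewrite -expRD ler_expR; nra.
have /andP[i0 ile] := mittag_leffler_inv_le a01 l0 T0.
have e0 := expR_gt0 (lambda * T).
apply: le_trans (ler_wpM2l (expR_ge0 _) ile) _.
rewrite -addrA ler_wpDl ?expR_ge0// expRN ler_pdivrMl// [leRHS]mulrDr mulr1.
apply: lerD; first by rewrite -expR0 ler_expR mulr_ge0// ltW.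
(* From y <= exp y at y = lambda T / 2, squared; the constant 4 / T^2 of the statement comes from
   here. *)
have X2 : (lambda * T) ^+ 2 <= 4 * expR (lambda * T).
  have h : 0 <= lambda * T / 2 by rewrite divr_ge0 ?mulr_ge0// ltW.
  have -> : lambda * T = lambda * T / 2 + lambda * T / 2 by exact: splitr.
  rewrite expRD; have := expR_ge1Dx (lambda * T / 2).
  move: h; move: (lambda * T / 2) (expR _) => y e y0 ye.
  have {}ye : y <= e by apply: le_trans ye; rewrite lerDr.
  have := ler_pM y0 y0 ye ye; nra.
have inv : (1 - alpha)^-1 <= lambda.
  by rewrite -[leLHS]mul1r ler_pdivrMr// ltW.
apply: (@le_trans _ _ ((1 + T) * lambda ^+ 2)).
  rewrite mulrCA ler_wpM2l ?addr_ge0 ?(ltW T0)// expr2.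
  by rewrite ler_wpM2l// ltW.
rewrite [leRHS]mulrCA ler_wpM2l ?addr_ge0 ?(ltW T0)//.
by rewrite mulrA ler_pdivlMr ?exprn_gt0// [expR _ * 4]mulrC -exprMn.
Qed.

(** As 0 <= q <= 1, one factor of q^2 is dropped before Bernoulli's inequality, so the square costs
    a single factor i: (q lambda)^2 <= i mu lambda^(2 - 2 s). The exponent is nonpositive since s >=
    1, so any lower bound l0 of the spectrum may replace lambda. *)
Lemma filtered_inverse_le alpha lambda l0 T mu s i : 0 < alpha < 1 ->
  0 < l0 <= lambda -> 0 < T -> 0 < mu -> 1 <= s ->
  mu * lambda `^ (- (2 * s)) <= 1 ->
  ((1 - (1 - mu * lambda `^ (- (2 * s))) ^+ i) /
     mittag_leffler alpha 1 (- lambda * T `^ alpha)) ^+ 2 <=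
  2 + 2 * (i%:R * (mu * l0 `^ (2 - 2 * s))) * ((1 + T) / (1 - alpha)) ^+ 2.
Proof.
move=> a01 /andP[l00 l0l] T0 mu0 s1 r1; have /andP[a0 a1] := a01.
have l_gt0 : 0 < lambda by exact: lt_le_trans l0l.
have rho01 : 0 <= mu * lambda `^ (- (2 * s)) <= 1.
  by rewrite r1 mulr_ge0 ?powR_ge0// ltW.
have /andP[i0 ile] := mittag_leffler_inv_le a01 l_gt0 T0.
have /andP[q0 q1] := landweber_filter_itv i rho01.
have qle := landweber_filter_le i rho01.
set q := 1 - _ ^+ i in q0 q1 qle *; set b := (1 + T) / (1 - alpha) in ile *.
have b0 : 0 <= b.
  by apply: divr_ge0; [rewrite addr_ge0 ?(ltW T0)|rewrite subr_ge0 ltW].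
have ql : (q * lambda) ^+ 2 <= i%:R * (mu * l0 `^ (2 - 2 * s)).
  rewrite exprMn; apply: (@le_trans _ _ (q * lambda ^+ 2)).
    by rewrite ler_wpM2r ?sqr_ge0// expr2 ler_piMl.
  apply: le_trans (ler_wpM2r (sqr_ge0 _) qle) _.
  rewrite -!mulrA ler_wpM2l// ler_wpM2l ?(ltW mu0)//.
  have -> : lambda `^ (- (2 * s)) * lambda ^+ 2 = lambda `^ (2 - 2 * s).
    rewrite -powR_mulrn ?(ltW l_gt0)// -powRD; first by rewrite addrC.
    by apply/implyP => _; rewrite gt_eqF.
  have -> : 2 - 2 * s = - (2 * s - 2) by ring.
  rewrite !powRN lef_pV2 ?posrE ?powR_gt0//.
  by apply: ge0_ler_powR; rewrite ?nnegrE ?(ltW l00) ?(ltW l_gt0)// subr_ge0; lra.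
have : q / mittag_leffler alpha 1 (- lambda * T `^ alpha) <= 1 + q * lambda * b.
  apply: le_trans (ler_wpM2l q0 ile) _.
  by rewrite mulrDr mulr1 mulrA lerD2r.
have : 0 <= q / mittag_leffler alpha 1 (- lambda * T `^ alpha).
  by rewrite mulr_ge0 ?(ltW i0).
move: (q / _) => z z0 zle.
have c0 : 0 <= q * lambda * b.
  by apply: mulr_ge0 => //; apply: mulr_ge0 => //; exact: ltW.
apply: (@le_trans _ _ ((1 + q * lambda * b) ^+ 2)).
  by rewrite lerXn2r ?nnegrE ?addr_ge0.
apply: (@le_trans _ _ (2 + 2 * (q * lambda * b) ^+ 2)).
  by have := sqr_ge0 (1 - q * lambda * b); nra.
by rewrite lerD2l [(q * lambda * b) ^+ 2]exprMn -mulrA ler_wpM2l// ler_wpM2r ?sqr_ge0.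
Qed.


End regularised_multipliers.

(** * Splitting the error into a noise-free part and propagated noise *)

Theorem theorem6p2 (R : realType) (n : nat) (Omega : set 'rV[R]_n.+1)
    (K : elliptic_coef R n)
    (lam : nat -> R) (phi : nat -> 'rV[R]_n.+1 -> R)
    (T mu C2 p s : R)
    (u0 : 'rV[R]_n.+1 -> R)
    (gd : R -> 'rV[R]_n.+1 -> R)
    (istop : R -> nat)
    (alpha : R -> R)
    (Omega_domain : admissible_domain Omega)
    (K_smooth : smooth_coef K)
    (K_elliptic : uniformly_elliptic Omega K)
    (A_self_adjoint : self_adjoint Omega (neg_elliptic_op Omega K))
    (A_positive : positive_op Omega (neg_elliptic_op Omega K))
    (A_eigen : eigensystem Omega (neg_elliptic_op Omega K) lam phi)
    (T_gt0 : 0 < T)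
    (mu_gt0 : 0 < mu)
    (mu_bound : forall f, L2 Omega f ->
       L2norm Omega (fun x => mu * frac_power Omega lam phi (- (2 * s)) f x)
       <= L2norm Omega f)
    (C2_gt0 : 0 < C2)
    (p_gt1 : 1 < p)
    (u0_reg : dotH Omega lam phi (2 * (1 + 1 / p)) u0)
    (u0_neq0 : ~ ae_on Omega (fun x => u0 x = 0))
    (gd_noise : \forall delta \near 0^'+,
       L2 Omega (gd delta) /\
       L2norm Omega (exp_op Omega lam phi T u0 \- gd delta) <= delta)
    (s_ge : 1 + 1 / p <= s)
    (istop_rate : exists c C : R, [/\ 0 < c, c <= C &
       \forall delta \near 0^'+,
         c * (T ^- 2 * ln (L2norm Omega u0 / delta)) <= (istop delta)%:R
         <= C * (T ^- 2 * ln (L2norm Omega u0 / delta))])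
    (alpha_itv : \forall delta \near 0^'+,
       0 < alpha (delta_tilde C2 T (L2norm Omega u0) delta) < 1)
    (alpha_to1 :
       alpha (delta_tilde C2 T (L2norm Omega u0) delta) @[delta --> 0^'+]
         --> (1 : R))
    (alpha_rate :
       delta_tilde C2 T (L2norm Omega u0) delta
         / (1 - alpha (delta_tilde C2 T (L2norm Omega u0) delta))
         @[delta --> 0^'+] --> (0 : R)) :
  L2norm Omega
    (reconstruction Omega lam phi T
       (alpha (delta_tilde C2 T (L2norm Omega u0) delta))
       (landweber Omega lam phi mu s (gd delta) (istop delta)) \- u0)
    @[delta --> 0^'+] --> (0 : R).
Proof.
pose leb := @lebesgueRV_measure R n.
have mO : measurable (Omega : set (lebesgueRV R n)).
  by case: Omega_domain => _ oO _ _ _; exact: open_lebesgue_measurable.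
have [lam0 lam_nd phi_eig ophi0 complete0] := A_eigen.
have sphi k : sqint leb Omega (phi k).
  by have [du [d2u [[[H _] _] _ _ _]]] := phi_eig k; exact: H.
have ophi j k : ip leb Omega (phi j) (phi k) = (j == k)%:R by exact: ophi0.
have complete f : sqint leb Omega f -> (forall k, ip leb Omega f (phi k) = 0) ->
    {ae leb, forall x, Omega x -> f x = 0} by exact: complete0.
have lam_gt0 k : 0 < lam k by apply: lt_le_trans lam0 (lam_nd _ _ (leq0n k)).
have su0 : sqint leb Omega u0 by case: u0_reg.
pose a k := ip leb Omega u0 (phi k).
pose U := L2norm Omega u0.
have U0 : 0 < U.
  rewrite lt_neqAle sqrtr_ge0 andbT; apply/negP => /eqP U0; apply: u0_neq0.
  apply: complete => // k; apply/eqP; rewrite -sqrf_eq0 eq_le sqr_ge0 andbT.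
  have := ip_CS mO su0 (sphi k); rewrite -(L2norm_sqr _ u0) -/U -U0 expr0n mul0r.
  by [].
pose rho k := mu * lam k `^ (- (2 * s)).
have rho_gt0 k : 0 < rho k by rewrite mulr_gt0// powR_gt0.
(* The operator bound is tested on the eigenfunction [phi k], whose image has [rho k] as its k-th
   coefficient; Cauchy-Schwarz compares that coefficient with the norm. *)
have rho_le1 k : rho k <= 1.
  have [sF cF] : sqint leb Omega (frac_power Omega lam phi (- (2 * s)) (phi k)) /\
      forall j, ip leb Omega (frac_power Omega lam phi (- (2 * s)) (phi k)) (phi j) =
        lam j `^ (- (2 * s)) * ip leb Omega (phi k) (phi j).
    apply: (spectral_opP mO sphi ophi (B := (lam k `^ (- (2 * s))) ^+ 2)) => // N.
    have [kN|Nk] := ltnP k N.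
      rewrite (bigD1_seq k) ?iota_uniq ?mem_index_iota//= big1 ?addr0.
        by rewrite ophi eqxx mulr1.
      by move=> j jk; rewrite ophi eq_sym (negbTE jk) mulr0 expr0n.
    rewrite big_nat big1 ?sqr_ge0// => j /andP[_ jN].
    by rewrite ophi gtn_eqF ?mulr0 ?expr0n// (leq_trans jN).
  have smF := sqintZ mO mu sF.
  have := mu_bound _ (sphi k); set G := (fun x => _) => GF.
  have G1 : ip leb Omega G G <= 1.
    rewrite -L2norm_sqr; have -> : 1 = L2norm Omega (phi k) ^+ 2 :> R.
      by rewrite L2norm_sqr -/leb ophi eqxx.
    by rewrite lerXn2r// nnegrE sqrtr_ge0.
  have := ip_CS mO smF (sphi k).
  rewrite (ipZl mO _ sF (sphi k)) cF ophi eqxx !mulr1 -/(rho k) => H.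
  have {}H := le_trans H G1.
  by rewrite -(@ler_pXn2r _ 2) ?nnegrE ?(ltW (rho_gt0 k))// expr1n.
have rho01 k : 0 <= rho k <= 1 by rewrite rho_le1 ltW.
have [sg cg] : sqint leb Omega (exp_op Omega lam phi T u0) /\
    forall k, ip leb Omega (exp_op Omega lam phi T u0) (phi k) = expR (- (lam k * T)) * a k.
  apply: (spectral_op_boundedP mO sphi ophi (M := 1)) => // k.
  by rewrite ger0_norm ?expR_ge0// -expR0 ler_expR oppr_le0 mulr_ge0// ltW.
pose dt delta := delta_tilde C2 T U delta.
pose al delta := alpha (dt delta).
pose E delta k := mittag_leffler (al delta) 1 (- lam k * T `^ al delta).
pose q delta k := 1 - (1 - rho k) ^+ istop delta.
have [c [C [c0 cC istop_bd]]] := istop_rate.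
have C0 : 0 < C by exact: lt_le_trans cC.
have s1 : 1 <= s.
  apply: le_trans s_ge; rewrite lerDl divr_ge0// ltW//; exact: lt_trans p_gt1.
pose K0 := mu * lam 0%N `^ (2 - 2 * s).
have K0_ge0 : 0 <= K0 by rewrite mulr_ge0 ?powR_ge0// ltW.
(* Bound on the squared noise amplification, from [filtered_inverse_le] with the smallest eigenvalue
   as [l0]. *)
pose M2 delta := 2 + 2 * ((istop delta)%:R * K0) * ((1 + T) / (1 - al delta)) ^+ 2.
(* Squared k-th error coefficient for noise-free data. *)
pose x delta k := (q delta k * expR (- (lam k * T)) / E delta k - 1) ^+ 2 * a k ^+ 2.
pose C1 := expR 2 + 1 + (1 + T) * (4 / T ^+ 2).
have C1_ge0 : 0 <= C1.
  by rewrite !addr_ge0 ?expR_ge0// mulr_ge0 ?addr_ge0 ?divr_ge0 ?exprn_ge0 ?(ltW T0)// ltW.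
(* The lower rate bound exceeds A as soon as delta <= U exp(- A T^2 / c). *)
have istop_oo : istop delta @[delta --> 0^'+] --> \oo.
  apply/cvgnyPge => A; near=> delta.
  have d0 : 0 < delta by near: delta; exact: nbhs_right_gt.
  have /andP[H _] : c * (T ^- 2 * ln (U / delta)) <= (istop delta)%:R
         <= C * (T ^- 2 * ln (U / delta)) by near: delta.
  rewrite -(ler_nat R); apply: le_trans H.
  have T2 : 0 < T ^+ 2 by rewrite exprn_gt0.
  rewrite -ler_pdivrMl// ler_pdivlMl//.
  rewrite -[leLHS]expRK ler_ln ?posrE ?expR_gt0 ?divr_gt0//.
  rewrite ler_pdivlMr// -ler_pdivlMl ?expR_gt0//.
  by near: delta; apply: nbhs_right_le; rewrite mulr_gt0// invr_gt0 expR_gt0.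
have q1 k : q delta k @[delta --> 0^'+] --> (1 : R).
  have r1 : `|1 - rho k| < 1.
    by rewrite ger0_norm ?subr_ge0// gtrBl.
  have H := cvg_comp _ _ istop_oo (cvg_expr r1).
  rewrite -[X in _ --> X]subr0; apply: cvgB; [exact: cvg_cst|exact: H].
have E1 k : E delta k @[delta --> 0^'+] --> expR (- (lam k * T)).
  exact: mittag_leffler_cvg_expR.
have x0 k : x delta k @[delta --> 0^'+] --> (0 : R).
  rewrite -[X in _ --> X](mul0r (a k ^+ 2)); apply: cvgMl.
  have H : q delta k * expR (- (lam k * T)) / E delta k - 1 @[delta --> 0^'+] --> (0 : R).
    rewrite -[X in _ --> X](_ : 1 * expR (- (lam k * T)) / expR (- (lam k * T)) - 1 = 0); last first.
      by rewrite mul1r divff ?subrr// gt_eqF// expR_gt0.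
    apply: cvgB; last exact: cvg_cst.
    apply: cvgM; first by apply: cvgMl; exact: q1.
    by apply: cvgV; [rewrite gt_eqF// expR_gt0|exact: E1].
  have := cvg_comp _ _ H (@exprn_continuous R 2 _).
  by rewrite expr0n.
(* (C1 + 1)^2 bounds (z - 1)^2 for 0 <= z <= C1, the range of the noise-free multiplier; Bessel's
   inequality makes the majorant summable. *)
have a_cvg : cvgn (series (fun k => (C1 + 1) ^+ 2 * a k ^+ 2)).
  apply: (@is_cvg_seriesZ _ (fun k => a k ^+ 2) ((C1 + 1) ^+ 2)).
  apply: nondecreasing_is_cvgn.
    apply/nondecreasing_seqP => m; rewrite -subr_ge0 sub_series leqnSn.
    by rewrite sumr_ge0// => k _; rewrite sqr_ge0.
  exists (ip leb Omega u0 u0) => _ [N _ <-]; exact: (bessel mO sphi ophi).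
have x_bd : \forall delta \near 0^'+, forall k, `|x delta k| <= (C1 + 1) ^+ 2 * a k ^+ 2.
  near=> delta => k.
  have al01 : 0 < al delta < 1 by near: delta.
  have ratio := mittag_leffler_ratio_le al01 (lam_gt0 k) T_gt0.
  have /andP[i0 _] := mittag_leffler_inv_le al01 (lam_gt0 k) T_gt0.
  have /andP[q0 q_le1] := landweber_filter_itv (istop delta) (rho01 k).
  rewrite /x normrM !ger0_norm ?sqr_ge0// ler_wpM2r ?sqr_ge0//.
  rewrite -/(q delta k) in q0 q_le1.
  have z0 : 0 <= q delta k * expR (- (lam k * T)) / E delta k.
    by rewrite mulr_ge0 ?(ltW i0)// mulr_ge0 ?expR_ge0.
  have z1 : q delta k * expR (- (lam k * T)) / E delta k <= C1.
    apply: le_trans ratio; rewrite -mulrA; apply: ler_piMl => //.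
    by apply: mulr_ge0; [exact: expR_ge0|exact: ltW i0].
  by move: z0 z1; move: (_ / E delta k) => z z0 z1; nra.
pose X delta := limn (series (x delta)).
have X0 : X delta @[delta --> 0^'+] --> (0 : R).
  rewrite -[X in _ --> X](_ : limn (series (fun=> 0 : R)) = 0).
    exact: tannery x_bd a_cvg x0.
  rewrite (_ : series _ = fun=> 0); first exact: lim_cst.
  by apply/funext => N; rewrite /series/= big1.
(* The stopping rule matches the noise level: T^(-2) ln(U / delta) delta^2 equals (delta~ / C2)^2,
   so i delta^2 <= (C / C2^2) delta~^2, and K1 collects the remaining constants. *)
have M20 : M2 delta * delta ^+ 2 @[delta --> 0^'+] --> (0 : R).
  pose K1 := 2 * (C / C2 ^+ 2) * K0 * (1 + T) ^+ 2.
  have d2 : 2 * (delta ^+ 2) @[delta --> 0^'+] --> (0 : R).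
    rewrite -[X in _ --> X](mulr0 2); apply: cvgMr.
    apply: cvg_at_right_filter.
    have : t ^+ 2 @[t --> (0 : R)] --> ((0 : R) ^+ 2) by exact: exprn_continuous.
    by rewrite expr0n.
  have L : 2 * delta ^+ 2 + K1 * (dt delta / (1 - al delta)) ^+ 2 @[delta --> 0^'+] --> (0 : R).
    rewrite -[X in _ --> X](_ : 0 + K1 * 0 ^+ 2 = 0); last by rewrite expr0n mulr0 addr0.
    apply: cvgD => //; apply: cvgMr.
    exact: (cvg_comp _ _ alpha_rate (@exprn_continuous R 2 _)).
  apply: (squeeze_cvgr _ (cvg_cst 0) L); near=> delta.
  have d0 : 0 < delta by near: delta; exact: nbhs_right_gt.
  have al01 : 0 < al delta < 1 by near: delta.
  have /andP[_ H] : c * (T ^- 2 * ln (U / delta)) <= (istop delta)%:R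
         <= C * (T ^- 2 * ln (U / delta)) by near: delta.
  (* Below U the logarithm is nonnegative, so the square root in [delta_tilde] squares back to
     it. *)
  have dU : delta <= U by near: delta; apply: nbhs_right_le.
  have ln0 : 0 <= ln (U / delta) by rewrite ln_ge0// ler_pdivlMr// mul1r.
  rewrite /M2; apply/andP; split.
    by rewrite mulr_ge0 ?sqr_ge0// addr_ge0// mulr_ge0 ?sqr_ge0// mulr_ge0// mulr_ge0.
  rewrite mulrDl lerD2l.
  have dtE : dt delta ^+ 2 = C2 ^+ 2 * (T ^- 2 * ln (U / delta)) * delta ^+ 2.
    by rewrite /dt /delta_tilde !exprMn sqr_sqrtr// -exprVn; ring.
  have C2n : C2 != 0 by rewrite gt_eqF.
  have -> : K1 * (dt delta / (1 - al delta)) ^+ 2 =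
      2 * ((C * (T ^- 2 * ln (U / delta))) * K0) * ((1 + T) / (1 - al delta)) ^+ 2 * delta ^+ 2.
    rewrite !expr_div_n dtE /K1; move: (_ * ln _) => Lg.
    have b0 : 1 - al delta != 0 by rewrite gt_eqF// subr_gt0; case/andP: al01.
    by field; rewrite C2n b0.
  rewrite ler_wpM2r ?sqr_ge0// ler_wpM2r ?sqr_ge0// ler_wpM2l// ler_wpM2r//.
apply/L2norm_cvg0.
have L : 2 * X delta + 2 * (M2 delta * delta ^+ 2) @[delta --> 0^'+] --> (0 : R).
  rewrite -[X in _ --> X](_ : 2 * 0 + 2 * 0 = 0); last by rewrite !mulr0 addr0.
  by apply: cvgD; apply: cvgMr.
apply: (squeeze_cvgr _ (cvg_cst 0) L); near=> delta.
rewrite ip_ge0 /=.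
have d0 : 0 < delta by near: delta; exact: nbhs_right_gt.
have al01 : 0 < al delta < 1 by near: delta.
have [sgd noise] : L2 Omega (gd delta) /\
  L2norm Omega (exp_op Omega lam phi T u0 \- gd delta) <= delta by near: delta.
have x_le : forall k, `|x delta k| <= (C1 + 1) ^+ 2 * a k ^+ 2 by near: delta.
have [sw cw] := landweber_coef mO sphi ophi (istop delta) mu_gt0 rho01 sgd.
have seta : sqint leb Omega (exp_op Omega lam phi T u0 \- gd delta) by exact: sqintB.
pose eta k := ip leb Omega (exp_op Omega lam phi T u0 \- gd delta) (phi k).
have eta_bd N : \sum_(0 <= k < N) eta k ^+ 2 <= delta ^+ 2.
  apply: le_trans (bessel mO sphi ophi N seta) _.
  by rewrite -L2norm_sqr lerXn2r ?nnegrE ?sqrtr_ge0 ?(ltW d0).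
have gdc k : ip leb Omega (gd delta) (phi k) = expR (- (lam k * T)) * a k - eta k.
  by rewrite /eta (ipBl mO sg sgd (sphi k)) cg; ring.
have qE k : (q delta k / E delta k) ^+ 2 <= M2 delta.
  apply: filtered_inverse_le => //; [|exact: rho_le1].
  by rewrite lam0 lam_nd.
have M2_ge0 : 0 <= M2 delta by apply: le_trans (qE 0%N); exact: sqr_ge0.
have [sr cr] : sqint leb Omega (reconstruction Omega lam phi T (al delta)
      (landweber Omega lam phi mu s (gd delta) (istop delta))) /\
    forall k, ip leb Omega (reconstruction Omega lam phi T (al delta)
      (landweber Omega lam phi mu s (gd delta) (istop delta))) (phi k) =
      (E delta k)^-1 * ip leb Omega (landweber Omega lam phi mu s (gd delta) (istop delta)) (phi k).
  (* No bound uniform in k is at hand for 1 / E alone; the filter q in the coefficients of the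
     smoothed data leaves q / E, which is bounded. *)
  apply: (spectral_opP mO sphi ophi (B := M2 delta * ip leb Omega (gd delta) (gd delta))) => // N.
  apply: le_trans (ler_wpM2l M2_ge0 (bessel mO sphi ophi N sgd)).
  rewrite mulr_sumr; apply: ler_sum => k _.
  rewrite cw mulrA exprMn ler_wpM2r ?sqr_ge0//.
  by rewrite [_^-1 * _]mulrC; exact: qE.
apply: (parseval_le mO sphi ophi complete); first exact: sqintB.
move=> N; apply: (@le_trans _ _ (\sum_(0 <= k < N) (2 * x delta k + 2 * (M2 delta * eta k ^+ 2)))).
  apply: ler_sum => k _.
  rewrite (ipBl mO sr su0 (sphi k)) cr cw gdc -/(a k) -/(rho k) -/(q delta k).
  have -> : (E delta k)^-1 * (q delta k * (expR (- (lam k * T)) * a k - eta k)) - a k =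
    (q delta k * expR (- (lam k * T)) / E delta k - 1) * a k - q delta k / E delta k * eta k.
    by ring.
  (* (y - z)^2 <= 2 y^2 + 2 z^2 separates the noise-free error y from the propagated noise z. *)
  apply: (@le_trans _ _ (2 * x delta k + 2 * ((q delta k / E delta k) ^+ 2 * eta k ^+ 2))).
    rewrite /x -!exprMn; move: (_ * a k) (_ * eta k) => y z.
    by have := sqr_ge0 (y + z); nra.
  by rewrite lerD2l ler_wpM2l// ler_wpM2r ?sqr_ge0.
rewrite big_split/= -!mulr_sumr lerD// ler_wpM2l//.
  apply: nondecreasing_cvgn_le.
    apply/nondecreasing_seqP => m; rewrite -subr_ge0 sub_series leqnSn.
    by rewrite sumr_ge0// => k _; rewrite /x mulr_ge0 ?sqr_ge0.
  exact: cvg_series_dominated x_le a_cvg.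
by rewrite ler_wpM2l.
Unshelve. all: by end_near. Qed.
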